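(* Let $N\ge1$, $X>0$, $0\le X_i^-\le X_i^+$, and let $B=\{x\in\mathbb{R}^N:\sum_i x_i=X,\ X_i^-\le x_i\le X_i^+\ \forall i\}$ be the (nonempty) feasible set of budgets, of radius $R$. For each term $k$ let $g_1(\cdot,k),\dots,g_N(\cdot,k)$ be random productivity functions whose means $\bar g_{i,k}(x)=\langle g_i(x,k)\rangle$ vanish at $0$ and are non-decreasing and concave in $x$. Let $g(x,k)=\sum_i g_i(x_i,k)$ and $\langle G(x,k)\rangle=\sum_{i=1}^N\int_0^{x_i}\frac{\bar g_{i,k}(y)}{y}\,dy$. Let $y^k\in B$ be the feasible budget maximizing $\langle G(x,k)\rangle$ over $x\in B$, and suppose $\|y^k-y^{k+1}\|\le\delta$ for all $k$. Let $(x^k)_k$ be the sequence of budgets produced by the average rates scheme A with learning rate $\epsilon>0$, $$x^{k+1}=\pi_B\big(x^k+\epsilon v^k\big),\qquad v^k=\Big(\frac{g_1^k}{x_1^k},\dots,\frac{g_N^k}{x_N^k}\Big),\qquad g_i^k=g_i(x_i^k,k).$$ Assume that there are constants $h,\gamma,\Gamma>0$ such that, for all $k$: (i) $\frac12\left|\frac{1}{x}\Big(\bar g_{i,k}'(x)-\frac{\bar g_{i,k}(x)}{x}\Big)\right|\ge h$ for all $i$ and all $x\in[X_i^-,X_i^+]$; (ii) $\gamma\,|g(x,k)-g(y,k)|\le\|x-y\|$ for all $x,y\in B$; (iii) $\|v^k\|\le\Gamma$; (iv) for fixed values of the outputs of the terms before $k$, the average of $v^k$ over the outputs $g^k$ of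 term $k$ equals the gradient $\nabla_x\langle G(x,k)\rangle$ at $x=x^k$. Then, for high $k$ and a suitably chosen learning rate (namely $\epsilon=\sqrt{\delta}\sqrt{\delta+2R}/\Gamma$), for $\theta>0$, $$\frac1k\sum_{j=1}^k\big|g(x^j,j)-g(y^j,j)\big|\le\theta\quad\text{with probability } 1-O\!\left(\frac{\delta^{1/4}}{\theta}\right);$$ more precisely, $$P\left(\left|\lim_{k\to\infty}\frac1k\sum_{j=1}^k \big(g(y^j,j)-g(x^j,j)\big)\right|\ge\theta\right)\le P\left(\lim_{k\to\infty}\frac1k\sum_{j=1}^k\big|g(y^j,j)-g(x^j,j)\big|\ge\theta\right)\le O\!\left(\frac{\delta^{1/4}}{\theta}\right).$$ In this sense, if the productivity functions change slowly with time, then with high probability $$\frac1k\sum_{j=1}^k g(x^j,j)\approx\frac1k\sum_{j=1}^k\langle g(y^j,j)\rangle ,$$ and hence, under capped funding conditions ($X_i^-=0$ for all $i$), the average rates scheme A is guaranteed to produce on average at least half of the optimal productivity, the optimal productivity at term $j$ being $\max_{x\in B}\langle g(x,j)\rangle$.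
   Context: $g_i(x,k)$ is the random scientific output of research unit $i$ in term $k$ when it receives funds $x$. $\langle\cdot\rangle$ denotes expectation, $\|\cdot\|$ the Euclidean norm, and $\pi_B(z)$ the point of $B$ closest to $z$ in Euclidean norm. The $O(\cdot)$ is with respect to $\delta$ and $\theta$, with the constants $h,\gamma,\Gamma,R$ fixed. *)

(* Defs.v *)
From HB Require Import structures.
From mathcomp Require Import all_boot all_order all_algebra.
From mathcomp Require Import all_classical all_reals all_analysis.
Import Order.TTheory GRing.Theory Num.Theory.
Import numFieldNormedType.Exports.

Set Implicit Arguments.
Unset Strict Implicit.
Unset Printing Implicit Defensive.

Local Open Scope classical_set_scope.
Local Open Scope ring_scope.

Section Budgets.
Context {R : realType} {N : nat}.
Implicit Types (x y z p w : 'rV[R]_N) (A : set 'rV[R]_N) (f : 'rV[R]_N -> R).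

Definition dotp x y : R := \sum_i x 0 i * y 0 i.

(* The library norm on 'rV[R]_N is the max norm, hence this one. *)
Definition enorm x : R := Num.sqrt (\sum_i x 0 i ^+ 2).

Definition feasible (X : R) (Xm Xp : 'I_N -> R) : set 'rV[R]_N :=
  [set x | \sum_i x 0 i = X /\ forall i, Xm i <= x 0 i <= Xp i].

Definition in_ball_of_radius A (r : R) : Prop :=
  exists c, forall x, A x -> enorm (x - c) <= r.

(* p = pi_A(z), the point of A closest to z. *)
Definition is_proj A z p : Prop :=
  A p /\ forall q, A q -> enorm (z - p) <= enorm (z - q).

Definition is_maximizer A f y : Prop := A y /\ forall x, A x -> f x <= f y.

(* w is the gradient at x of f, a function of budgets, i.e. of vectors with
   nonnegative coordinates. If all the coordinates of x are positive this is
   the usual (Frechet) gradient; if x 0 i = 0 its i-th coordinate is the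
   one-sided derivative. It is unique in all cases. *)
Definition is_gradient f x w : Prop :=
  forall e, 0 < e -> exists2 r, 0 < r &
    forall z, (forall i, 0 <= z 0 i) -> enorm (z - x) <= r ->
      `|f z - f x - dotp w (z - x)| <= e * enorm (z - x).

End Budgets.

Section Productivity.
Context {d : measure_display} {T : measurableType d} {R : realType}.
Context (P : probability T R) {N : nat}.
(* g i x k is the random output of unit i in term k with funds x. *)
Variable g : 'I_N -> R -> nat -> {RV P >-> R}.

Definition gbar (i : 'I_N) (k : nat) (x : R) : R := fine ('E_P[g i x k]).

Definition gtot (x : 'rV[R]_N) (k : nat) (w : T) : R :=
  \sum_i g i (x 0 i) k w.

Definition gtot_mean (x : 'rV[R]_N) (k : nat) : R :=
  \sum_i gbar i k (x 0 i).

Definition Gmean (x : 'rV[R]_N) (k : nat) : R :=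
  \sum_i \int[lebesgue_measure]_(t in `[0, x 0 i]) (gbar i k t / t).

Definition optimal_productivity (B : set 'rV[R]_N) (k : nat) : R :=
  sup [set gtot_mean x k | x in B].

(* r is the rate "output o over funds x". An unfunded unit has no output (no
   finite rate exists otherwise); its rate 0/0 is then left unspecified rather
   than set to the library's value 0 / 0 = 0, which would be incompatible with
   its mean being the derivative at 0 of the mean output. *)
Definition is_rate (o x r : R) : Prop :=
  if x == 0 then o = 0 else r = o / x.

Definition average_rates_scheme (B : set 'rV[R]_N) (eps : R) (x0 : 'rV[R]_N)
    (x v : nat -> T -> 'rV[R]_N) : Prop :=
  [/\ forall w, x 0 w = x0,
      forall k w i, is_rate (g i (x k w 0 i) k w) (x k w 0 i) (v k w 0 i) &
      forall k w, is_proj B (x k w + eps *: v k w) (x k.+1 w)].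

(* The information given by the outputs (and the rates, which are functions of
   the outputs except for unfunded units) of the terms before k. *)
Definition past (x v : nat -> T -> 'rV[R]_N) (k : nat) : set (set T) :=
  <<s [set A | exists j i (S : set R), [/\ (j < k)%N, measurable S &
         A = (fun w => v j w 0 i) @^-1` S \/
         A = (fun w => g i (x j w 0 i) j w) @^-1` S]] >>.

(* D is (a version of) the conditional expectation of V given F. *)
Definition is_cond_expectation (F : set (set T)) (V D : T -> R) : Prop :=
  [/\ P.-integrable setT (EFin \o V),
      P.-integrable setT (EFin \o D),
      forall S, measurable S -> F (D @^-1` S) &
      forall A, F A ->
        (\int[P]_(w in A) (V w)%:E = \int[P]_(w in A) (D w)%:E)%E].

End Productivity.

(* The average of the first k terms of u; terms are numbered from 0. *)
Definition avg {R : realType} (u : nat -> R) (k : nat) : R :=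
  k%:R^-1 * \sum_(j < k) u j.

(* Main.v *)
(** The squared distance of the budget x^k to the maximizer y^k is a Lyapunov
   function.  Projections onto B are nonexpansive, so for every outcome the
   average of v^j . (y^j - x^j) is at most O(1/k) + O(sqrt delta).  Hypothesis
   (i) makes <G> strongly concave on B, whence
   (h/4) |x^j - y^j|^2 <= D^j . (y^j - x^j), where D^j is the gradient at x^j.
   By (iv) the differences (v^j - D^j) . u^j, for u^j bounded and determined by
   the past, are bounded and orthogonal: their averages tend to 0 almost surely
   and in quadratic mean.  Hence the averages of |x^j - y^j|^2 are eventually
   O(sqrt delta), those of |x^j - y^j| are O(delta^(1/4)), and (ii) transfers
   this to the outputs.  For outputs against mean outputs take u^j = x^j, as
   D^j . x^j is the mean output at x^j; the factor 1/2 comes from moving funds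
   between two units at the maximizer of <G>. *)
Require Import Defs.
From HB Require Import structures.
From mathcomp Require Import all_boot all_order all_algebra.
From mathcomp Require Import all_classical all_reals all_analysis.
From mathcomp Require Import measurable_realfun zify ring lra.
Import Order.TTheory GRing.Theory Num.Theory.
Import numFieldNormedType.Exports.

Set Implicit Arguments.
Unset Strict Implicit.
Unset Printing Implicit Defensive.

Local Open Scope classical_set_scope.
Local Open Scope ring_scope.

(** * Euclidean geometry of budgets and projections *)

(** The exponent 1/4 comes from [s] = delta^(1/4): strong concavity controls squared distances, on
    average O(sqrt delta) = O(s^2), while (ii) needs the distances themselves. Squares are turned
    into distances by AM-GM with parameter [s] instead of a square root of the average, so the noise
    enters linearly and one Chebyshev estimate handles it; its factor 1/s is harmless because delta
    is fixed while k grows. The index from which the bound holds must not depend on theta. This is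
    possible because the claim is trivial for theta below twice the deterministic error, and above
    it a tail bound of order 1/(k theta^2) is uniform. Two probabilistic points shape the proof.
    That the budgets are determined by the past has to be derived, from the projections being
    nonexpansive; and the gradients D^j are bounded only almost surely, so they are cut off at
    Gamma. For a unit without funds neither the rate nor (i) gives information: there the one-sided
    derivative is compared with rates at points strictly to the right. *)

Section Euclidean.
Context {R : realType} {N : nat}.
Implicit Types (a b c u p q z : 'rV[R]_N) (A : set 'rV[R]_N).

Lemma dotpC a b : dotp a b = dotp b a.
Proof. by apply: eq_bigr => i _; rewrite mulrC. Qed.

Lemma dotpDl a b c : dotp (a + b) c = dotp a c + dotp b c.
Proof. by rewrite -big_split; apply: eq_bigr => i _; rewrite !mxE mulrDl. Qed.

Lemma dotpZl (t : R) a c : dotp (t *: a) c = t * dotp a c.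
Proof. by rewrite mulr_sumr; apply: eq_bigr => i _; rewrite !mxE mulrA. Qed.

Lemma dotpNl a c : dotp (- a) c = - dotp a c.
Proof. by rewrite -scaleN1r dotpZl mulN1r. Qed.

Lemma dotpDr a b c : dotp c (a + b) = dotp c a + dotp c b.
Proof. by rewrite !(dotpC c) dotpDl. Qed.

Lemma dotpZr (t : R) a c : dotp c (t *: a) = t * dotp c a.
Proof. by rewrite !(dotpC c) dotpZl. Qed.

Lemma dotpNr a c : dotp c (- a) = - dotp c a.
Proof. by rewrite !(dotpC c) dotpNl. Qed.

Definition dotpE := (dotpDl, dotpDr, dotpNl, dotpNr, dotpZl, dotpZr).

Lemma dotpBB a b : dotp (a - b) (a - b) = dotp a a - 2 * dotp a b + dotp b b.
Proof. by rewrite !dotpE (dotpC b a); ring. Qed.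

Lemma dotp_ge0 a : 0 <= dotp a a.
Proof. by apply: sumr_ge0 => i _; rewrite -expr2 sqr_ge0. Qed.

Lemma enorm_sqr a : enorm a ^+ 2 = dotp a a.
Proof. by rewrite sqr_sqrtr ?sumr_ge0// => i _; exact: sqr_ge0. Qed.

Lemma enorm_ge0 a : 0 <= enorm a.
Proof. exact: sqrtr_ge0. Qed.

Lemma dotp_eq0 a b : dotp b b = 0 -> dotp a b = 0.
Proof.
move=> /psumr_eq0P bb; apply: big1 => i _.
suff /eqP : b 0 i * b 0 i = 0 by rewrite mulf_eq0 orbb => /eqP ->; rewrite mulr0.
by apply: bb => // j _; rewrite -expr2 sqr_ge0.
Qed.

Lemma dotp_le_enorm a b : `|dotp a b| <= enorm a * enorm b.
Proof.
rewrite -(ler_pXn2r (n := 2))// ?nnegrE ?mulr_ge0 ?enorm_ge0//.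
rewrite exprMn !enorm_sqr real_normK ?num_real//.
have [/eqP b0|b0] := eqVneq (dotp b b) 0.
  by rewrite dotp_eq0 ?expr0n ?mulr_ge0 ?dotp_ge0//; exact/eqP.
have bp : 0 < dotp b b by rewrite lt_def b0 dotp_ge0.
(* Expanded, this square is [dotp b b] times the difference to be shown nonnegative. *)
have := dotp_ge0 (dotp b b *: a - dotp a b *: b).
rewrite !dotpE (dotpC b a) => hh.
rewrite -subr_ge0 -(pmulr_rge0 _ bp).
by move: hh; congr (_ <= _); ring.
Qed.

Lemma enormD a b : enorm (a + b) <= enorm a + enorm b.
Proof.
rewrite -(ler_pXn2r (n := 2))// ?nnegrE ?addr_ge0 ?enorm_ge0//.
have := ler_norml (dotp a b) (enorm a * enorm b).
rewrite dotp_le_enorm => /esym/andP[_].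
rewrite sqrrD !enorm_sqr !dotpE (dotpC b a); lra.
Qed.

Lemma enormN a : enorm (- a) = enorm a.
Proof. by congr Num.sqrt; apply: eq_bigr => i _; rewrite mxE sqrrN. Qed.

Lemma enormB a b : enorm (a - b) = enorm (b - a).
Proof. by rewrite -enormN opprB. Qed.

Lemma coord_le_enorm a i : `|a 0 i| <= enorm a.
Proof.
rewrite -sqrtr_sqr ler_sqrt ?sumr_ge0// => [|j _]; last exact: sqr_ge0.
by rewrite (bigD1 i)//= lerDl sumr_ge0// => j _; exact: sqr_ge0.
Qed.

Lemma enorm_le_sum a : enorm a <= \sum_i `|a 0 i|.
Proof.
rewrite -(ler_pXn2r (n := 2))// ?nnegrE ?enorm_ge0 ?sumr_ge0//.
rewrite enorm_sqr expr2 mulr_suml ler_sum// => i _.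
rewrite -expr2 -real_normK ?num_real// expr2 ler_wpM2l//.
by rewrite (bigD1 i)//= lerDl sumr_ge0.
Qed.

Lemma in_ball_diameter A (r : R) a b : in_ball_of_radius A r -> A a -> A b ->
  enorm (a - b) <= 2 * r.
Proof.
move=> [c Ac] /Ac ac /Ac bc.
rewrite -(subrK c a) -addrA (le_trans (enormD _ _))//.
by rewrite (enormB c); lra.
Qed.

Definition convex_budgets A :=
  forall (t : R) a b, 0 <= t <= 1 -> A a -> A b -> A (a + t *: (b - a)).

Lemma feasible_convex (X : R) (Xm Xp : 'I_N -> R) :
  convex_budgets (feasible X Xm Xp).
Proof.
move=> t a b t01 [aX ab] [bX bb]; split=> [|i].
  under eq_bigr => i _ do rewrite !mxE.
  rewrite big_split/= -mulr_sumr sumrB aX bX; lra.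
rewrite !mxE; have := ab i; have := bb i => bi ai; apply/andP; split; nra.
Qed.

Lemma proj_obtuse A z p q : convex_budgets A -> is_proj A z p -> A q ->
  dotp (z - p) (q - p) <= 0.
Proof.
move=> cA [Ap pmin] Aq; rewrite leNgt; apply/negP => dp.
set m := dotp (z - p) (q - p) in dp *; set n := dotp (q - p) (q - p).
have n0 : 0 <= n := dotp_ge0 _.
(* With t (m + n) = m, moving from [p] by [t] towards [q] changes the squared distance to [z] by
   -2tm + t^2 n = -tm(1 + t) < 0, against minimality. *)
pose t := m / (m + n).
have mn : 0 < m + n by lra.
have t0 : 0 < t by rewrite divr_gt0.
have t1 : t <= 1 by rewrite ler_pdivrMr//; lra.
have /pmin : A (p + t *: (q - p)) by apply: cA => //; rewrite (ltW t0).
rewrite -(ler_pXn2r (n := 2))// ?nnegrE ?enorm_ge0// !enorm_sqr opprD addrA.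
rewrite (dotpBB (z - p)) !dotpZr dotpZl -/m -/n => tm.
have tmn : t * (m + n) = m by rewrite divfK// gt_eqF.
nra.
Qed.

(** Adding the two obtuse-angle inequalities gives |p - p'|^2 <= (z - z').(p - p'); the rest is the
    nonnegative square of (z - z') - (p - p'). *)
Lemma proj_nonexpansive A z z' p p' : convex_budgets A ->
  is_proj A z p -> is_proj A z' p' -> enorm (p - p') <= enorm (z - z').
Proof.
move=> cA pz pz'.
have h1 := proj_obtuse cA pz (proj1 pz').
have h2 := proj_obtuse cA pz' (proj1 pz).
rewrite -(ler_pXn2r (n := 2))// ?nnegrE ?enorm_ge0// !enorm_sqr.
have h3 := dotp_ge0 ((z - z') - (p - p')).
have h4 : dotp (z - z') (p - p') = dotp (p - p') (p - p') -
   dotp (z - p) (p' - p) - dotp (z' - p') (p - p').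
  rewrite !dotpE; ring.
by rewrite dotpBB in h3; lra.
Qed.

Lemma proj_id A a : A a -> is_proj A a a.
Proof.
move=> Aa; split=> // q _; rewrite subrr; have := enorm_ge0 (a - q).
suff -> : enorm (0 : 'rV[R]_N) = 0 by [].
by rewrite /enorm big1 ?sqrtr0// => i _; rewrite mxE expr0n.
Qed.

(** One step of the Lyapunov argument, with [b] and [c] the maximizers of successive terms. As [b]
    is its own projection, |p - b| <= |a + eps u - b|. Replacing [b] by [c] costs 2 delta |p - b| +
    delta^2, where |p - b| is at most the diameter 2r. *)
Lemma proj_step A (r eps delta G : R) a u p b c : convex_budgets A ->
    in_ball_of_radius A r -> A b -> A c -> 0 <= eps ->
    is_proj A (a + eps *: u) p -> enorm (b - c) <= delta -> enorm u <= G ->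
  2 * eps * dotp u (b - a) <= enorm (a - b) ^+ 2 - enorm (p - c) ^+ 2 +
    (eps ^+ 2 * G ^+ 2 + delta ^+ 2 + 4 * r * delta).
Proof.
move=> cA Ar Ab Ac eps0 pa bc uG.
have pb := proj_nonexpansive cA pa (proj_id Ab).
have pb2 : enorm (p - b) ^+ 2 <= enorm (a + eps *: u - b) ^+ 2.
  by rewrite ler_pXn2r// nnegrE enorm_ge0.
have diam := in_ball_diameter Ar (proj1 pa) Ab.
have pc : enorm (p - c) <= enorm (p - b) + delta.
  by rewrite -(subrK b p) -addrA (le_trans (enormD _ _))// subrK lerD2l.
have u2 : enorm u ^+ 2 <= G ^+ 2.
  by rewrite ler_pXn2r// ?nnegrE ?enorm_ge0//; exact: le_trans (enorm_ge0 _) uG.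
have d0 : 0 <= delta by exact: le_trans (enorm_ge0 _) bc.
have pc2 : enorm (p - c) ^+ 2 <= (enorm (p - b) + delta) ^+ 2.
  by rewrite ler_pXn2r// ?nnegrE ?addr_ge0 ?enorm_ge0.
have E : enorm (a + eps *: u - b) ^+ 2 =
    enorm (a - b) ^+ 2 - 2 * eps * dotp u (b - a) + eps ^+ 2 * enorm u ^+ 2.
  rewrite !enorm_sqr !dotpE (dotpC a u) (dotpC b u) (dotpC b a); ring.
have := ler_wpM2l (sqr_ge0 eps) u2.
have := ler_wpM2r d0 diam.
move: pc2; rewrite E in pb2; rewrite sqrrD => *; lra.
Qed.

End Euclidean.

(** * Measurability *)

Section MeasurableLipschitz.
Context {d : measure_display} {T : measurableType d} {R : realType} {N : nat}.

Lemma measurable_set_lt (f g : T -> R) : measurable_fun setT f ->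
  measurable_fun setT g -> measurable [set w | f w < g w].
Proof.
move=> mf mg; have := measurable_fun_ltr mf mg.
by move=> /(_ measurableT [set true] Logic.I); rewrite setTI.
Qed.

Lemma measurable_set_le (f g : T -> R) : measurable_fun setT f ->
  measurable_fun setT g -> measurable [set w | f w <= g w].
Proof.
move=> mf mg; have := measurable_fun_ler mf mg.
by move=> /(_ measurableT [set true] Logic.I); rewrite setTI.
Qed.

(* Superlevel sets of [p] are unions of preimages under [Z] of rational boxes. *)
Lemma measurable_fun_lipschitz (Z : T -> 'rV[R]_N) (p : T -> R) :
    (forall i, measurable_fun setT (fun w => Z w 0 i)) ->
    (forall w w', `|p w - p w'| <= enorm (Z w - Z w')) ->
  measurable_fun setT p.
Proof.
move=> mZ pZ.
apply: (measurability _ (RGenOInfty.measurableE R)) => //.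
move=> _ [_ [a ->] <-]; rewrite setTI.
pose box (c : 'rV[rat]_N * rat) : set T :=
  \bigcap_(i in [set: 'I_N]) [set w | `|Z w 0 i - ratr (c.1 0 i)| < ratr c.2].
pose good c := if `[< box c `<=` p @^-1` `]a, +oo[ >] then box c else set0.
suff -> : p @^-1` `]a, +oo[ = \bigcup_c good c.
  apply: countable_bigcupT_measurable => // c; rewrite /good.
  case: ifPn => // _; apply: fin_bigcap_measurable => // i _.
  apply: measurable_set_lt => //.
  apply: measurableT_comp => //; exact: measurable_funB.
apply/seteqP; split=> [w|w [c _]]; last first.
  by rewrite /good; case: asboolP => // cp /cp.
move=> /=; rewrite in_itv/= andbT => pw.
(* Two points of a box of half-width rho < r are at distance at most 2 N rho, less than the gap p w
   - a, so the whole box stays above [a]. The 1 keeps this strict, also for N = 0. *)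
pose r := (p w - a) / (2 * N%:R + 1).
have r0 : 0 < r by rewrite divr_gt0 ?subr_gt0// ltr_wpDl// mulr_ge0.
have [rho] := rat_in_itvoo r0; rewrite in_itv/= => /andP[rho0 rhor].
have /choice[q qP] (i : 'I_N) : exists q : rat, `|Z w 0 i - ratr q| < ratr rho.
  have : Z w 0 i - ratr rho < Z w 0 i + ratr rho by lra.
  move=> /rat_in_itvoo[q]; rewrite in_itv/= => /andP[q1 q2].
  by exists q; rewrite ltr_norml; apply/andP; split; lra.
pose c := (\row_i q i, rho).
have cw : box c w by move=> i _ /=; rewrite mxE.
exists c => //; rewrite /good; case: asboolP => // -[] w' cw' /=.
rewrite in_itv/= andbT.
have h1 : enorm (Z w - Z w') <= 2 * N%:R * ratr rho.
  apply: (le_trans (enorm_le_sum _)).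
  rewrite mulrAC mulr_natr -[X in _ *+ X]card_ord -sumr_const.
  apply: ler_sum => i _; rewrite !mxE.
  have := cw' i Logic.I; have := cw i Logic.I => /=.
  move: (ratr (_ 0 i)) => e; rewrite !ltr_norml ler_norml => /andP[? ?] /andP[? ?].
  by apply/andP; split; lra.
have rE : r * (2 * N%:R + 1) = p w - a.
  by rewrite divfK// gt_eqF// ltr_wpDl// mulr_ge0.
have h2 : 2 * N%:R * ratr rho <= 2 * N%:R * r by rewrite ler_wpM2l// ?mulr_ge0 ?ltW.
have := pZ w w'; rewrite ler_norml => /andP[_ h3]; lra.
Qed.

End MeasurableLipschitz.

(** * Integrals against a sub-sigma-algebra *)

Section BoundedIntegrands.
Context {d : measure_display} {T : measurableType d} {R : realType}.
Context {P : probability T R}.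
Implicit Types (U Z f : T -> R) (M : R).

Lemma bounded_fun_near Z M : (forall w, `|Z w| <= M) ->
  [bounded Z w | w in [set: T]].
Proof.
move=> ZM; exists M; split=> [|y My w _]; first exact: num_real.
exact: le_trans (ZM w) (ltW My).
Qed.

Lemma integrable_bounded Z M : measurable_fun setT Z ->
  (forall w, `|Z w| <= M) -> P.-integrable setT (EFin \o Z).
Proof.
move=> mZ ZM; apply: measurable_bounded_integrable => //.
  exact: le_lt_trans (probability_le1 P measurableT) (ltry _).
exact: bounded_fun_near ZM.
Qed.

Lemma integrable_mul_bounded U Z M : P.-integrable setT (EFin \o U) ->
    measurable_fun setT Z -> (forall w, `|Z w| <= M) ->
  P.-integrable setT (EFin \o (fun w => U w * Z w)).
Proof.
move=> iU mZ ZM.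
exact: (integrableMl measurableT iU mZ (bounded_fun_near ZM)).
Qed.

Lemma Rintegral_sum (I : Type) (r : seq I) (f : I -> T -> R) :
    (forall i, P.-integrable setT (EFin \o f i)) ->
  P.-integrable setT (EFin \o (fun w => \sum_(i <- r) f i w)) /\
  \int[P]_w (\sum_(i <- r) f i w) = \sum_(i <- r) \int[P]_w f i w.
Proof.
move=> fi; elim: r => [|i r [IHi IH]].
  split.
    rewrite (_ : _ \o _ = cst 0%E); first exact: integrable0.
    by apply/funext => w /=; rewrite big_nil.
  rewrite big_nil (_ : (fun _ => _) = cst 0).
    by rewrite Rintegral_cst// mul0r.
  by apply/funext => w /=; rewrite big_nil.
have E : (fun w => \sum_(j <- i :: r) f j w) = (fun w => f i w + \sum_(j <- r) f j w).
  by apply/funext => w; rewrite big_cons.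
rewrite E big_cons/= RintegralD// IH; split=> //.
by apply: (integrableD measurableT (fi i) IHi).
Qed.

End BoundedIntegrands.

(** The sum counts the positive integers up to [a], so it is the floor of [a]. This writes a
    function with values in [0, n], up to an error 1, as a sum of [n] indicators of superlevel
    sets. *)
Lemma count_nat_le {R : realType} (a : R) (n : nat) : 0 <= a <= n%:R ->
  `|a - \sum_(m < n) (m.+1%:R <= a)%R%:R| <= 1.
Proof.
elim: n => [|n IH] /andP[a0 an].
  by rewrite big_ord0 subr0 ger0_norm//; apply: le_trans an _.
rewrite big_ord_recr/=; have [na|na] := leP a n%:R.
  rewrite (_ : (n.+1%:R <= a) = false) /= ?addr0; first by apply: IH; rewrite a0.
  by apply/negbTE; rewrite -ltNge (le_lt_trans na)// ltr_nat.
have -> : \sum_(m < n) (m.+1%:R <= a)%R%:R = n%:R :> R.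
  rewrite (eq_bigr (fun=> 1)) ?sumr_const ?card_ord// => m _.
  by rewrite (_ : _ <= _)//; apply: le_trans (ltW na); rewrite ler_nat.
rewrite -natr1 in an *; case: (leP (n%:R + 1) a) => /= [na1|na1].
  have -> : a = n%:R + 1 by apply/eqP; rewrite eq_le an.
  by rewrite subrr normr0.
by rewrite addr0 ger0_norm ?subr_ge0 ?lerBlDl ?ltW.
Qed.

Section SubSigmaAlgebra.
Context {d : measure_display} {T : measurableType d} {R : realType}.
Context {P : probability T R}.
Implicit Types (G : set (set T)) (f U Z : T -> R) (M : R).

Definition g_measurable G f :=
  measurable_fun (setT : set (g_sigma_algebraType G)) f.

Lemma g_sigma_sub G : G `<=` measurable -> <<s G >> `<=` measurable.
Proof. by apply: smallest_sub; exact: sigma_algebra_measurable. Qed.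

Lemma g_measurable_set G f S : g_measurable G f -> measurable S ->
  <<s G >> (f @^-1` S).
Proof. by move=> mf mS; have := mf measurableT S mS; rewrite setTI. Qed.

Lemma g_measurableW G f : G `<=` measurable -> g_measurable G f ->
  measurable_fun setT f.
Proof.
move=> GT mf _ S mS; rewrite setTI.
by apply: (g_sigma_sub GT); exact: g_measurable_set.
Qed.

Lemma g_measurable_sub G G' f : G `<=` G' -> g_measurable G f ->
  g_measurable G' f.
Proof.
move=> GG' mf _ S mS; rewrite setTI.
by apply: (sub_sigma_algebra2 GG'); exact: g_measurable_set.
Qed.

(* The bounded factor is approximated uniformly by simple functions. *)
Lemma Rintegral_orthogonal G U Z M : G `<=` measurable ->
    P.-integrable setT (EFin \o U) ->
    (forall A, <<s G >> A -> \int[P]_(w in A) U w = 0) ->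
    g_measurable G Z -> (forall w, `|Z w| <= M) ->
  \int[P]_w (U w * Z w) = 0.
Proof.
move=> GT iU U0 gZ ZM.
have mZ := g_measurableW GT gZ.
have iUZ := integrable_mul_bounded iU mZ ZM.
have iaU : P.-integrable setT (EFin \o (fun w => `|U w|)).
  by have := integrable_abse iU; apply: eq_integrable.
set I := \int[P]_w _; pose K := \int[P]_w `|U w|.
have K0 : 0 <= K by exact: Rintegral_ge0.
pose L := `|M| + 1.
have L0 : 0 < L by rewrite ltr_wpDl.
have ZL w : - L <= Z w <= L.
  by rewrite -ler_norml (le_trans (ZM w))// (le_trans (ler_norm _))// lerDl.
(* [I] does not depend on [n], so a bound of order 1/n forces it to vanish. *)
suff main n : (0 < n)%N -> `|I| * n%:R <= 2 * L * K.
  apply/eqP; rewrite -normr_eq0 eq_le normr_ge0 andbT leNgt; apply/negP => I0.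
  have := archi_boundP (divr_ge0 (mulr_ge0 (mulr_ge0 (ler0n _ 2) (ltW L0)) K0) (ltW I0)).
  set n := Num.bound _; rewrite ltr_pdivrMr// => /lt_le_trans/(_ _)-/(_ (`|I| * n.+1%:R)).
  rewrite mulrC ler_wpM2l// ?ler_nat// => /(_ isT).
  by rewrite ltNge main.
move=> n0; have n0' : 0 < n%:R :> R by rewrite ltr0n.
(* Rescaling to [0, n] makes the unit error of the floor small relative to [Z]; the shift by [L]
   does not matter since [U] integrates to 0. *)
pose a w := n%:R / (2 * L) * (Z w + L).
have c0 : 0 < n%:R / (2 * L) by rewrite divr_gt0// mulr_gt0.
have an w : 0 <= a w <= n%:R.
  have /andP[z1 z2] := ZL w.
  rewrite /a mulr_ge0 ?(ltW c0)//=; last by lra.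
  rewrite mulrAC ler_pdivrMr ?mulr_gt0// ler_pM2l//; lra.
pose s w := \sum_(m < n) ((m.+1%:R <= a w)%R%:R : R).
have sa w : `|a w - s w| <= 1 by exact: count_nat_le.
pose F (m : nat) w := U w * (m.+1%:R <= a w)%R%:R.
have ga : g_measurable G a.
  by apply: measurable_funM => //; exact: measurable_funD.
have gA (m : nat) : <<s G >> [set w | m.+1%:R <= a w].
  exact: (@measurable_set_le _ (g_sigma_algebraType G) R (cst m.+1%:R) a).
have mem_in (m : nat) w : (w \in [set w | m.+1%:R <= a w]) = (m.+1%:R <= a w).
  by apply/idP/idP; rewrite inE.
have FE m : F m = U \_ [set w | m.+1%:R <= a w].
  apply/funext => w; rewrite /F patchE (mem_in m w).
  by case: (_ <= _); rewrite ?mulr1 ?mulr0.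
have mb (m : nat) : measurable_fun setT (fun w => (m.+1%:R <= a w)%R%:R : R).
  have ->: (fun w => (m.+1%:R <= a w)%R%:R : R) = \1_[set w | m.+1%:R <= a w].
    by apply/funext => w; rewrite indicE mem_in.
  apply/measurable_indicP.
  exact: (g_sigma_sub GT (gA m)).
have iF m : P.-integrable setT (EFin \o F m).
  apply: (integrable_mul_bounded iU (mb m) (M := 1)) => w.
  by case: (m.+1%:R <= a w); rewrite ?normr1 ?normr0.
have [isF sF] := Rintegral_sum (index_enum 'I_n) (fun m : 'I_n => iF m).
have sF0 : \int[P]_w (U w * s w) = 0.
  rewrite (_ : (fun w => U w * s w) = (fun w => \sum_(j < n) F j w)).
    by rewrite sF big1// => m _; rewrite FE -Rintegral_mkcond U0.
  by apply/funext => w; rewrite mulr_sumr.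
have iUs : P.-integrable setT (EFin \o (fun w => U w * s w)).
  apply: eq_integrable isF => // w _ /=; congr _%:E.
  by rewrite mulr_sumr.
have ma : measurable_fun setT a by exact: g_measurableW ga.
have iUa : P.-integrable setT (EFin \o (fun w => U w * a w)).
  apply: (integrable_mul_bounded iU ma (M := n%:R)) => w.
  by have /andP[? ?] := an w; rewrite ger0_norm.
have IE : I = 2 * L / n%:R * \int[P]_w (U w * a w).
  have -> : (fun w => U w * a w) =
      (fun w => n%:R / (2 * L) * (U w * Z w) + n%:R / 2 * U w).
    apply/funext => w; rewrite /a; field; exact: lt0r_neq0.
  rewrite RintegralD//; first 1 last.
  - exact: (integrableZl measurableT _ iUZ).
  - exact: (integrableZl measurableT _ iU).
  rewrite !RintegralZl// U0; last exact: (@measurableT _ (g_sigma_algebraType G)).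
  rewrite -/I; field; rewrite (lt0r_neq0 L0) (lt0r_neq0 n0') //.
have h1 : `|\int[P]_w (U w * a w)| <= K.
  have -> : \int[P]_w (U w * a w) = \int[P]_w (U w * a w - U w * s w).
    by rewrite RintegralB// sF0 subr0.
  have iB : P.-integrable setT (EFin \o (fun w => U w * a w - U w * s w)).
    exact: (integrableB measurableT iUa iUs).
  apply: (le_trans (le_normr_Rintegral measurableT iB)).
  apply: le_Rintegral => //.
    by have := integrable_abse iB; apply: eq_integrable.
  by move=> w _; rewrite -mulrBr normrM ler_piMr.
rewrite IE normrM gtr0_norm ?divr_gt0 ?mulr_gt0//.
rewrite mulrAC divfK ?lt0r_neq0// ler_wpM2l// mulr_ge0//; exact: ltW.
Qed.

End SubSigmaAlgebra.

(** * A strong law for bounded orthogonal sequences *)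

Section AlmostSure.
Context {d : measure_display} {T : measurableType d} {R : realType}.
Variable P : probability T R.

Lemma le_measure_ae (A B : set T) : measurable A -> measurable B ->
  (\forall w \ae P, A w -> B w) -> (P A <= P B)%E.
Proof.
move=> mA mB [N [mN N0 subN]].
rewrite -[leRHS]adde0 -[X in (_ <= _ + X)%E]N0.
apply: le_trans (measureU2 _ mB mN).
apply: le_measure; rewrite ?inE//; first exact: measurableU.
move=> w Aw; have [Bw|nBw] := pselect (B w); [by left|right].
by apply: subN => /(_ Aw).
Qed.

Lemma measure_ae0 (A : set T) : measurable A -> (\forall w \ae P, ~ A w) ->
  P A = 0%E.
Proof.
move=> mA nA; apply/eqP; rewrite eq_le measure_ge0 andbT.
by rewrite -(measure0 P); apply: le_measure_ae.
Qed.

Lemma chebyshev_sqr (X : T -> R) (K a : R) : measurable_fun setT X ->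
    (forall w, `|X w| <= K) -> 0 < a ->
  (P [set w | (a <= `|X w|)%R] <= (a ^- 2 * \int[P]_w (X w ^+ 2))%:E)%E.
Proof.
move=> mX XK a0.
have mX2 : measurable_fun setT (fun w => X w ^+ 2) by exact: measurable_funX.
have iX2 : P.-integrable setT (EFin \o (fun w => X w ^+ 2)).
  apply: (integrable_bounded (M := K ^+ 2)) => // w.
  rewrite normrX ler_pXn2r ?nnegrE//; exact: le_trans (XK w).
have := le_integral_abse P measurableT (measurable_int _ iX2) (exprn_gt0 2 a0) => /=.
rewrite setTI.
have -> : [set w | ((a ^+ 2)%R%:E <= `|(X w ^+ 2)%R%:E|)%E] =
    [set w | a <= `|X w|].
  have a0' := ltW a0.
  by apply/seteqP; split=> w /=; rewrite lee_fin normrX ler_pXn2r ?nnegrE.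
have -> : (\int[P]_w `|(X w ^+ 2)%R%:E| =
    (\int[P]_w (X w ^+ 2))%R%:E)%E.
  rewrite /Rintegral fineK; last exact: integrable_fin_num.
  by apply: eq_integral => w _ /=; rewrite ger0_norm ?sqr_ge0.
have fP : P [set w | a <= `|X w|] \is a fin_num.
  apply: fin_num_measure; apply: measurable_set_le => //.
  exact: measurableT_comp.
by rewrite -(fineK fP) -EFinM !lee_fin mulrC -ler_pdivlMr ?exprn_gt0// mulrC.
Qed.

End AlmostSure.

Lemma measurable_avg {d : measure_display} {T : measurableType d} {R : realType}
    (f : nat -> T -> R) (k : nat) : (forall j, measurable_fun setT (f j)) ->
  measurable_fun setT (fun w => avg (f^~ w) k).
Proof. by move=> mf; apply: measurable_funM => //; exact: measurable_sum. Qed.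

Lemma sum_inv_sqr_le {R : realType} n : \sum_(m < n) (m.+1%:R ^- 2) <= 2 :> R.
Proof.
(* The claim is strengthened so that induction applies: 1/(x+1)^2 <= 1/x - 1/(x+1). *)
suff : \sum_(m < n.+1) (m.+1%:R ^- 2) <= 2 - n.+1%:R^-1 :> R.
  rewrite big_ord_recr/= => /le_trans - /(_ 2).
  rewrite gerBl invr_ge0 ler0n => /(_ isT); apply: le_trans.
  by rewrite lerDl invr_ge0 exprn_ge0.
elim: n => [|n IH].
  by rewrite big_ord_recr big_ord0/= expr1n invr1; lra.
rewrite big_ord_recr/=; apply: (le_trans (lerD IH (lexx _))).
rewrite -(natr1 n.+1); have : 0 < n.+1%:R :> R by rewrite ltr0n.
move: n.+1%:R => x x0.
rewrite -subr_ge0.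
have -> : 2 - (x + 1)^-1 - (2 - x^-1 + (x + 1) ^- 2) = (x * (x + 1) ^+ 2)^-1.
  by field; rewrite !lt0r_neq0// addr_gt0.
by rewrite invr_ge0 mulr_ge0 ?exprn_ge0 ?addr_ge0 ?ltW.
Qed.

Section StrongLaw.
Context {d : measure_display} {T : measurableType d} {R : realType}.
Variables (P : probability T R) (xi : nat -> T -> R) (M : R).
Hypothesis mxi : forall j, measurable_fun setT (xi j).
Hypothesis xiM : forall j w, `|xi j w| <= M.
Hypothesis xi_orth : forall i j, (i < j)%N -> \int[P]_w (xi i w * xi j w) = 0.

Let S (n : nat) (w : T) : R := \sum_(j < n) xi j w.

Let M_ge0 : 0 <= M.
Proof. by have := xiM 0 point; apply: le_trans. Qed.

Let mS n : measurable_fun setT (S n).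
Proof. exact: measurable_sum. Qed.

Let S_le n w : `|S n w| <= n%:R * M.
Proof.
apply: (le_trans (ler_norm_sum _ _ _)); rewrite mulr_natl.
rewrite -[X in _ *+ X]card_ord -sumr_const.
by apply: ler_sum => i _; exact: xiM.
Qed.

Let integrable_mul (f g : T -> R) (A B : R) :
    measurable_fun setT f -> measurable_fun setT g ->
    (forall w, `|f w| <= A) -> (forall w, `|g w| <= B) ->
  P.-integrable setT (EFin \o (fun w => f w * g w)).
Proof.
move=> mf mg fA gB; apply: (integrable_mul_bounded (M := B)) => //.
exact: integrable_bounded fA.
Qed.

(** Orthogonality removes the cross terms, so the second moment grows like n and not like n^2. *)
Lemma Rintegral_sqr_sum n : \int[P]_w (S n w ^+ 2) <= n%:R * M ^+ 2.
Proof.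
elim: n => [|n IH].
  rewrite (_ : (fun _ => _) = cst 0) ?Rintegral_cst ?mul0r//.
  by apply/funext => w; rewrite /S big_ord0 expr0n.
have iSS := integrable_mul (mS n) (mS n) (S_le n) (S_le n).
have iSx := integrable_mul (mS n) (mxi n) (S_le n) (xiM n).
have ixx := integrable_mul (mxi n) (mxi n) (xiM n) (xiM n).
have -> : (fun w => S n.+1 w ^+ 2) =
    (fun w => S n w * S n w + (2 * (S n w * xi n w) + xi n w * xi n w)).
  by apply/funext => w; rewrite /S big_ord_recr/=; ring.
have i2 : P.-integrable setT (EFin \o (fun w => 2 * (S n w * xi n w))).
  exact: (integrableZl measurableT _ iSx).
rewrite RintegralD//; last exact: (integrableD measurableT i2 ixx).
rewrite RintegralD// RintegralZl//.
have -> : \int[P]_w (S n w * xi n w) = 0.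
  have ij j : P.-integrable setT (EFin \o (fun w => xi j w * xi n w)).
    exact: integrable_mul (mxi j) (mxi n) (xiM j) (xiM n).
  have [_ E] := Rintegral_sum (index_enum 'I_n) (fun j : 'I_n => ij j).
  rewrite (_ : (fun _ => _) = (fun w => \sum_(j < n) xi j w * xi n w)).
    by rewrite E big1// => j _; exact: xi_orth.
  by apply/funext => w; rewrite mulr_suml.
rewrite mulr0 add0r -natr1 mulrDl mul1r; apply: (lerD IH).
have icst : P.-integrable setT (EFin \o cst (M ^+ 2)).
  by apply: (integrable_bounded (M := M ^+ 2)) => // w; rewrite ger0_norm ?sqr_ge0.
apply: (@le_trans _ _ (\int[P]_w (cst (M ^+ 2) w))).
  apply: le_Rintegral => // w _ /=.
  rewrite -expr2 -real_normK ?num_real// ler_pXn2r ?nnegrE//.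
rewrite Rintegral_cst// [X in fine X](_ : _ = 1%E) ?mulr1//; exact: probability_setT.
Qed.

Lemma chebyshev_avg k a : (0 < k)%N -> 0 < a ->
  (P [set w | (a <= `|avg (xi^~ w) k|)%R] <= (M ^+ 2 / (k%:R * a ^+ 2))%:E)%E.
Proof.
move=> k0 a0; have k0' : 0 < k%:R :> R by rewrite ltr0n.
have -> : [set w | a <= `|avg (xi^~ w) k|] = [set w | a * k%:R <= `|S k w|].
  apply/seteqP; split=> w /=; rewrite /avg -/(S k w) normrM ger0_norm ?invr_ge0//;
    by rewrite [_^-1 * _]mulrC ler_pdivlMr.
apply: (le_trans (chebyshev_sqr _ (mS k) (S_le k) (mulr_gt0 a0 k0'))).
rewrite lee_fin mulrC ler_pdivrMr ?exprn_gt0 ?mulr_gt0//.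
apply: (le_trans (Rintegral_sqr_sum k)); rewrite le_eqVlt; apply/orP; left.
by apply/eqP; field; rewrite !lt0r_neq0.
Qed.

(* Along the squares the second moments are summable; between consecutive
   squares the averages of a bounded sequence hardly move. *)
Lemma strong_law : \forall w \ae P, forall a, 0 < a ->
  exists K, forall k, (K <= k)%N -> `|avg (xi^~ w) k| < a.
Proof.
pose F (l n : nat) : set T :=
  [set w | (l.+1%:R^-1 : R) <= `|avg (xi^~ w) (n.+1 ^ 2)|].
have mF l n : measurable (F l n).
  apply: measurable_set_le => //; apply: measurableT_comp => //.
  exact: measurable_avg.
(* Borel-Cantelli: by Chebyshev at k = (n+1)^2 the probability of [F l n] is at most M^2 (l+1)^2 /
   (n+1)^2, which is summable in [n]. *)
have F0 l : P (lim_sup_set (F l)) = 0%E.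
  apply: lim_sup_set_cvg0 => //.
  set c : R := M ^+ 2 * l.+1%:R ^+ 2.
  have c0 : 0 <= c by rewrite mulr_ge0 ?exprn_ge0.
  apply: (@le_lt_trans _ _ (c * 2)%:E); last exact: ltry.
  apply: lime_le; first by apply: is_cvg_nneseries => n _ _; exact: measure_ge0.
  apply: nearW => n; rewrite big_mkord.
  apply: (@le_trans _ _ (\sum_(m < n) (c * m.+1%:R ^- 2)%:E)%E).
    apply: lee_sum => m _; apply: le_trans (chebyshev_avg _ _) _; rewrite ?expn_gt0 ?invr_gt0//.
    rewrite lee_fin le_eqVlt; apply/orP; left; apply/eqP; rewrite /c natrX.
    have : l.+1%:R != 0 :> R by rewrite pnatr_eq0.
    have : m.+1%:R != 0 :> R by rewrite pnatr_eq0.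
    move: m.+1%:R l.+1%:R => x y x0 y0.
    by field; rewrite x0 y0.
  by rewrite sumEFin lee_fin -mulr_sumr ler_wpM2l ?sum_inv_sqr_le.
have : \forall w \ae P, forall l, ~ lim_sup_set (F l) w.
  apply: ae_foralln => l; exists (lim_sup_set (F l)); split=> //.
    by apply: bigcap_measurable => // n _; apply: bigcup_measurable.
  exact: F0.
  by move=> w /= /contrapT.
apply: filterS => w Fw a a0.
(* Half of [a] is for the average at a square, the other half for the move from that square to
   [k]. *)
pose l := Num.bound (2 / a).
have la : l.+1%:R^-1 < a / 2.
  rewrite -[a / 2]invrK invf_div ltf_pV2 ?posrE ?divr_gt0//.
  apply: lt_trans (archi_boundP _) _; rewrite ?divr_ge0 ?ltr_nat//; exact: ltW.
have [m Fm] : exists m, forall n, (m <= n)%N -> ~ F l n w.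
  have := Fw l; rewrite /lim_sup_set => /existsNP[m]/not_implyP[_ nm].
  by exists m => n mn Fn; apply: nm; exists n.
(* From (n+1)^2 to k < (n+2)^2 at most 2(n+1) terms are added, worth at most 2(n+1)M; n >= q makes
   this at most (a/2)(n+1)^2. *)
pose q := Num.bound (4 * M / a).
pose n0 := (maxn m q).+1.
exists (n0 ^ 2)%N => k n0k.
have [n /andP[nk kn]] : exists n, (n.+1 ^ 2 <= k < n.+2 ^ 2)%N.
  have ex : exists n, (n ^ 2 <= k)%N by exists n0.
  have ub n : (n ^ 2 <= k)%N -> (n <= k)%N.
    by apply: leq_trans; rewrite -mulnn; case: n => // n; rewrite leq_pmulr.
  have := ex_maxnP ex ub; case=> -[|n] nk nmax.
    by have := nmax _ n0k; rewrite /n0.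
  exists n; rewrite nk ltnNge /=; apply/negP => /nmax; by rewrite ltnn.
have n0n : (n0 <= n.+1)%N.
  rewrite -ltnS -(ltn_sqr n0 n.+2); exact: leq_ltn_trans n0k kn.
have mn : (m <= n)%N by move: n0n; rewrite /n0 ltnS geq_max => /andP[].
have qn : (q <= n)%N by move: n0n; rewrite /n0 ltnS geq_max => /andP[].
have := Fm n mn; rewrite /F/= => /negP; rewrite -ltNge => avg1.
have x0 : 0 < n.+1%:R :> R by rewrite ltr0n.
have k0 : 0 < k%:R :> R by rewrite ltr0n; apply: leq_trans nk; rewrite expn_gt0.
have kx : n.+1%:R ^+ 2 <= k%:R :> R by rewrite -natrX ler_nat.
have Sk : `|S k w| <= `|S (n.+1 ^ 2) w| + 2 * n.+1%:R * M.
  have -> : S k w = S (n.+1 ^ 2) w + \sum_(n.+1 ^ 2 <= j < k) xi j w.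
    by rewrite /S -!(big_mkord xpredT (xi^~ w)) -big_cat_nat.
  rewrite (le_trans (ler_normD _ _))// lerD2l.
  rewrite (le_trans (ler_norm_sum _ _ _))//.
  apply: (@le_trans _ _ (\sum_(n.+1 ^ 2 <= j < k) M)).
    by apply: ler_sum => j _; exact: xiM.
  rewrite sumr_const_nat -[M *+ _]mulr_natl ler_wpM2r// -natrM ler_nat.
  rewrite leq_subLR -ltnS (leq_trans kn)//.
  rewrite -!mulnn; lia.
have S1 : `|S (n.+1 ^ 2) w| < a / 2 * n.+1%:R ^+ 2.
  rewrite -ltr_pdivrMr ?exprn_gt0// mulrC; apply: lt_trans la.
  move: avg1; rewrite /avg -/(S _ w) normrM ger0_norm ?invr_ge0// natrX //.
have Mq : 4 * M < a * n.+1%:R.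
  rewrite [a * _]mulrC -ltr_pdivrMr//.
  apply: lt_trans (archi_boundP _) _.
    by rewrite divr_ge0 ?mulr_ge0 ?(ltW a0)// .
  by rewrite ltr_nat ltnS.
have xM : 2 * n.+1%:R * M <= a / 2 * n.+1%:R ^+ 2.
  rewrite expr2; nra.
rewrite /avg -/(S k w) normrM ger0_norm ?invr_ge0 ?ltW// mulrC ltr_pdivrMr//.
nra.
Qed.

End StrongLaw.

(** * Errors that vanish both in probability, at a rate, and almost surely *)

Section Vanishing.
Context {d : measure_display} {T : measurableType d} {R : realType}.
Variable P : probability T R.
Implicit Types (W Q : nat -> T -> R).

(** The tail bound, uniform in the threshold, serves the statements at finite k, whose starting
    index may not depend on theta; the almost sure clause serves the statements on limits. *)
Definition vanishing W := [/\ forall k, measurable_fun setT (W k),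
  exists2 K : R, 0 <= K & forall k a, (0 < k)%N -> 0 < a ->
    (P [set w | (a <= W k w)%R] <= (K / (k%:R * a ^+ 2))%:E)%E &
  \forall w \ae P, forall a, 0 < a ->
    exists K, forall k, (K <= k)%N -> W k w < a].

Lemma vanishing_avg (xi : nat -> T -> R) (M : R) :
    (forall j, measurable_fun setT (xi j)) -> (forall j w, `|xi j w| <= M) ->
    (forall i j, (i < j)%N -> \int[P]_w (xi i w * xi j w) = 0) ->
  vanishing (fun k w => `|avg (xi^~ w) k|).
Proof.
move=> mxi xiM orth; split.
- by move=> k; apply: measurableT_comp => //; exact: measurable_avg.
- by exists (M ^+ 2); [exact: sqr_ge0|move=> k a; exact: chebyshev_avg].
- exact: strong_law orth.
Qed.

Lemma vanishingD W1 W2 (L : R) : 0 < L -> vanishing W1 -> vanishing W2 ->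
  vanishing (fun k w => L * W1 k w + W2 k w).
Proof.
move=> L0 [m1 [K1 K10 p1] s1] [m2 [K2 K20 p2] s2]; split.
- move=> k; apply: measurable_funD => //; exact: measurable_funM.
(* If the sum reaches [a], then [W1] reaches a/(2L) or [W2] reaches a/2; the constants are those of
   the two tail bounds. *)
- exists (4 * L ^+ 2 * K1 + 4 * K2).
    by rewrite addr_ge0 ?mulr_ge0 ?exprn_ge0// ltW.
  move=> k a k0 a0.
  have k0' : 0 < k%:R :> R by rewrite ltr0n.
  pose A1 := [set w | a / (2 * L) <= W1 k w].
  pose A2 := [set w | a / 2 <= W2 k w].
  have mA1 : measurable A1 by exact: measurable_set_le.
  have mA2 : measurable A2 by exact: measurable_set_le.
  apply: (@le_trans _ _ (P (A1 `|` A2))).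
    apply: le_measure; rewrite ?inE.
    + apply: measurable_set_le => //; apply: measurable_funD => //.
      exact: measurable_funM.
    + exact: measurableU.
    + move=> w /= aw; have [h|h] := leP (a / (2 * L)) (W1 k w); first by left.
      right; rewrite /A2/=; move: h; rewrite ltr_pdivlMr ?mulr_gt0// => h; nra.
  apply: (le_trans (measureU2 _ mA1 mA2)).
  apply: le_trans (leeD (p1 k _ k0 _) (p2 k _ k0 _)) _.
  + by rewrite divr_gt0 ?mulr_gt0.
  + by rewrite divr_gt0.
  rewrite -EFinD lee_fin le_eqVlt; apply/orP; left; apply/eqP.
  by field; rewrite !lt0r_neq0.
- apply: filterS2 s1 s2 => w w1 w2 a a0.
  have [|n1 h1] := w1 (a / (2 * L)); first by rewrite divr_gt0 ?mulr_gt0.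
  have [|n2 h2] := w2 (a / 2); first by rewrite divr_gt0.
  exists (maxn n1 n2) => k; rewrite geq_max => /andP[/h1 + /h2].
  rewrite ltr_pdivlMr ?mulr_gt0// => ? ?; nra.
Qed.

(* The trivial bound is used for small [theta]; only larger ones matter. *)
Lemma prob_le_of_vanishing Q W (c : R) (K0 : nat) : 0 < c ->
    (forall k, measurable_fun setT (Q k)) -> vanishing W ->
    (\forall w \ae P, forall k, (K0 <= k)%N -> Q k w <= c + W k w) ->
  exists K : nat, forall k, (K <= k)%N -> forall theta : R, 0 < theta ->
    ((1 - 2 * c / theta)%:E <= P [set w | (Q k w <= theta)%R])%E.
Proof.
move=> c0 mQ [mW [B B0 pW] _] QW.
(* For theta > 2c, failure forces W >= theta/2, of probability at most 4B/(k theta^2). Once k >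
   B/c^2 this is below 4c^2/theta^2 < 2c/theta, for all such theta at once. *)
exists (maxn K0 (Num.bound (B / c ^+ 2))) => k.
rewrite geq_max => /andP[K0k kB] theta th0.
have kB' : B < k%:R * c ^+ 2.
  rewrite -ltr_pdivrMr ?exprn_gt0//.
  apply: (lt_le_trans (archi_boundP _)); last by rewrite ler_nat.
  by rewrite divr_ge0 ?exprn_ge0// ltW.
have [thc|thc] := leP theta (2 * c).
  apply: (@le_trans _ _ 0%E); last exact: measure_ge0.
  by rewrite lee_fin subr_le0 ler_pdivlMr// mul1r.
have mA : measurable [set w | theta < Q k w] by exact: measurable_set_lt.
have -> : [set w | Q k w <= theta] = ~` [set w | theta < Q k w].
  by apply/seteqP; split=> w /=; rewrite leNgt => /negP.
rewrite probability_setC// EFinB leeB// .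
apply: (@le_trans _ _ (P [set w | theta / 2 <= W k w])).
  apply: le_measure_ae => //; first exact: measurable_set_le.
  apply: filterS QW => w /(_ _ K0k) /= h1 h2; lra.
have k0' : 0 < k%:R :> R by rewrite -(pmulr_lgt0 _ (exprn_gt0 2 c0)) (le_lt_trans B0).
have k0 : (0 < k)%N by rewrite ltr0n in k0'.
have th2 : 0 < theta / 2 by rewrite divr_gt0.
apply: (le_trans (pW k _ k0 th2)).
rewrite lee_fin ler_pdivrMr ?mulr_gt0 ?exprn_gt0//.
have -> : 2 * c / theta * (k%:R * (theta / 2) ^+ 2) = k%:R * c * (theta / 2).
  by field; rewrite lt0r_neq0.
apply: (le_trans (ltW kB')); rewrite expr2 mulrA ler_wpM2l ?mulr_ge0 ?ltW//; lra.
Qed.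

Lemma limn_esup_le_of_eventually (u : nat -> R) (c : R) :
    (forall a, 0 < a -> exists K, forall k, (K <= k)%N -> u k <= c + a) ->
  (limn_esup (fun k => (u k)%:E) <= c%:E)%E.
Proof.
move=> uc; apply/lee_addgt0Pr => a a0.
have [K uK] := uc a a0.
rewrite limn_esup_lim.
apply: lime_le; first exact: is_cvg_esups.
exists K => // n /= Kn; rewrite /esups/= /ereal_sup.
apply: ge_ereal_sup => _ [k /= nk <-].
by rewrite -EFinD lee_fin uK// (leq_trans Kn).
Qed.

Lemma le_limn_esup (u1 u2 : nat -> \bar R) : (forall k, (u1 k <= u2 k)%E) ->
  (limn_esup u1 <= limn_esup u2)%E.
Proof.
move=> u12; rewrite !limn_esup_lim; apply: lee_lim; [exact: is_cvg_esups..|].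
apply: nearW => n; apply: ge_ereal_sup => _ [k nk <-].
by apply: le_trans (u12 k) _; apply: ereal_sup_ubound; exists k.
Qed.

Lemma measurable_limn_esup_ge Q (a : R) : (forall k, measurable_fun setT (Q k)) ->
  measurable [set w | (a%:E <= limn_esup (fun k => (Q k w)%:E))%E].
Proof.
move=> mQ; rewrite -[X in measurable X]setTI.
apply: emeasurable_fun_c_infty => //.
apply: (@measurable_fun_limn_esup _ T R setT (fun k w => (Q k w)%:E)) => k.
exact/measurable_EFinP.
Qed.

(** Almost surely the limit superior is at most [c], so the event is null when theta > 2c; for
    smaller theta the right-hand side is at least 1. *)
Lemma prob_limn_esup_of_vanishing Q W (c : R) (K0 : nat) : 0 < c ->
    (forall k, measurable_fun setT (Q k)) -> vanishing W ->
    (\forall w \ae P, forall k, (K0 <= k)%N -> Q k w <= c + W k w) ->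
  forall theta : R, 0 < theta ->
    (P [set w | theta%:E <= limn_esup (fun k => (Q k w)%:E)] <=
     (2 * c / theta)%:E)%E.
Proof.
move=> c0 mQ [mW _ sW] QW theta th0.
have mA := measurable_limn_esup_ge theta mQ.
have [thc|thc] := leP theta (2 * c).
  apply: (@le_trans _ _ 1%E); first exact: probability_le1.
  by rewrite lee_fin ler_pdivlMr// mul1r.
rewrite measure_ae0//; first by rewrite lee_fin divr_ge0 ?mulr_ge0 ?ltW.
apply: filterS2 sW QW => w w1 w2 /= thw.
suff : (limn_esup (fun k => (Q k w)%:E) <= c%:E)%E.
  by move=> /(le_trans thw); rewrite lee_fin; lra.
apply: limn_esup_le_of_eventually => a a0.
have [K h] := w1 a a0; exists (maxn K0 K) => k.
rewrite geq_max => /andP[/w2 + /h]; lra.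
Qed.

End Vanishing.

(** * One productivity function *)

Section Productivity1.
Context {R : realType}.
Implicit Types (f : R -> R) (a b s t x y z D e h : R).

(** The hypotheses on one mean output. The last clause makes [rate_integral] a genuine Lebesgue
    integral, additive over intervals. *)
Definition productivity f := [/\ f 0 = 0,
  {in `[0, +oo[ &, {homo f : a b / a <= b}},
  convex_function (`[0, +oo[%classic : set R) (fun a => - f a) &
  forall a, 0 <= a -> lebesgue_measure.-integrable `[0, a]
                        (EFin \o (fun t => f t / t))].

Definition rate_integral f x := \int[lebesgue_measure]_(t in `[0, x]) (f t / t).

(** What [is_gradient] says along one coordinate: the derivative at positive [x], the right
    derivative at 0. *)
Definition is_derive_ge0 (G : R -> R) x D := forall e, 0 < e ->
  exists2 r, 0 < r & forall z, 0 <= z -> `|z - x| <= r ->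
    `|G z - G x - D * (z - x)| <= e * `|z - x|.

Variable f : R -> R.
Hypothesis pf : productivity f.

Local Notation G := (rate_integral f).

Lemma productivity_ge0 a : 0 <= a -> 0 <= f a.
Proof.
move=> a0; have [f0 fm _ _] := pf; rewrite -f0; apply: fm => //;
  by rewrite in_itv/= ?lexx ?a0.
Qed.

(** The rate is the slope of the chord from the origin: apply concavity to [s] as a convex
    combination of [t] and 0, where [f] vanishes. *)
Lemma rate_nonincreasing s t : 0 < s -> s <= t -> f t / t <= f s / s.
Proof.
move=> s0 st; have [f0 _ fc _] := pf.
have t0 : 0 < t by exact: lt_le_trans st.
have p01 : 0 <= s / t <= 1.
  by rewrite divr_ge0 ?(ltW s0) ?(ltW t0)//= ler_pdivrMr// mul1r.
pose p : {i01 R} := Itv01 (andP p01).1 (andP p01).2.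
have := fc p t 0; rewrite !inE/= !in_itv/= !andbT lexx (ltW t0).
move=> /(_ isT isT).
rewrite [X in - f X](_ : _ = s); last first.
  transitivity (s / t * t + (1 - s / t) * 0); first by [].
  by rewrite mulr0 addr0 divfK// gt_eqF.
rewrite convRE /= f0 oppr0 mulr0 addr0.
rewrite mulrN lerN2 => h.
rewrite ler_pdivlMr//; apply: le_trans h; rewrite le_eqVlt; apply/orP; left.
by apply/eqP; field; exact: lt0r_neq0.
Qed.

Let integrable_sub a b : 0 <= a -> a <= b ->
  lebesgue_measure.-integrable `]a, b] (EFin \o (fun t => f t / t)).
Proof.
move=> a0 ab; have [_ _ _ fi] := pf.
apply: (integrableS _ _ _ (fi b (le_trans a0 ab))) => //.
by apply: subset_itvr; rewrite bnd_simp.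
Qed.

Let integrable_cst a b (c : R) :
  lebesgue_measure.-integrable `]a, b] (EFin \o cst c).
Proof.
apply: measurable_bounded_integrable => //.
  by rewrite /= lebesgue_measure_itv/=; case: ifP => // _; rewrite ltry.
exists `|c|; split=> [|y cy w _ /=]; first exact: num_real.
exact: ltW.
Qed.

Let Rintegral_itv_cst a b (c : R) : a <= b ->
  \int[lebesgue_measure]_(t in `]a, b]) cst c t = c * (b - a).
Proof.
move=> ab; rewrite Rintegral_cst//= lebesgue_measure_itv/=.
rewrite lte_fin; case: ltgtP ab => // -> _.
by rewrite /= subrr.
Qed.

Let rate_integralB a b : 0 <= a -> a <= b ->
  G b - G a = \int[lebesgue_measure]_(t in `]a, b]) (f t / t).
Proof.
move=> a0 ab; have [_ _ _ fi] := pf.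
by apply: Rintegral_itvB; rewrite ?bnd_simp//; apply: fi; exact: le_trans ab.
Qed.

Lemma rate_integral_ge a b : 0 <= a -> a <= b ->
  (b - a) * (f b / b) <= G b - G a.
Proof.
move=> a0 ab; rewrite rate_integralB// mulrC -(Rintegral_itv_cst _ ab).
apply: le_Rintegral => //; first exact: integrable_sub.
move=> t /=; rewrite in_itv/= => /andP[at_ tb].
apply: rate_nonincreasing => //; exact: le_lt_trans at_.
Qed.

(** With a free constant and a bound on ]a, b] only, this also covers a = 0, where [c] will be the
    derivative at 0 in place of a rate. *)
Lemma rate_integral_le a b (c : R) : 0 <= a -> a <= b ->
    (forall t, a < t -> t <= b -> f t / t <= c) ->
  G b - G a <= (b - a) * c.
Proof.
move=> a0 ab tc; rewrite rate_integralB// mulrC -(Rintegral_itv_cst _ ab).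
apply: le_Rintegral => //; first exact: integrable_sub.
by move=> t /=; rewrite in_itv/= => /andP[at_ tb]; exact: tc.
Qed.

Lemma rate_integral_le_rate a b : 0 < a -> a <= b ->
  G b - G a <= (b - a) * (f a / a).
Proof.
move=> a0 ab; apply: rate_integral_le => // [|t ta _]; first exact: ltW.
by apply: rate_nonincreasing => //; exact: ltW.
Qed.

(** Difference quotients just to the right of [x] are averages of rates at points before [s], hence
    at least the rate at [s]. This is the substitute for [derive_eq_rate] when x = 0. *)
Lemma rate_le_derive x D s : 0 <= x -> is_derive_ge0 G x D -> x < s ->
  f s / s <= D.
Proof.
move=> x0 GD xs; apply/ler_addgt0Pr => e e0.
have [r r0 /(_ (x + Num.min r (s - x)))] := GD e e0.
set m := Num.min _ _.
have m0 : 0 < m by rewrite lt_min r0 subr_gt0.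
have mr : m <= r by rewrite ge_min lexx.
have ms : m <= s - x by rewrite ge_min lexx orbT.
rewrite (addrC x m) addrK gtr0_norm// => /(_ _ mr).
rewrite addr_ge0 ?(ltW m0)// => /(_ isT).
rewrite ler_norml => /andP[_ h].
have := @rate_integral_ge x (m + x) x0; rewrite addrK lerDr (ltW m0) => /(_ isT) h2.
have h3 : f s / s <= f (m + x) / (m + x).
  by apply: rate_nonincreasing; lra.
rewrite -(ler_pM2l m0); nra.
Qed.

(** Monotonicity of the rates replaces continuity of [f]: right difference quotients are at most the
    rate at [x], left ones at least that rate. *)
Lemma derive_eq_rate x D : 0 < x -> is_derive_ge0 G x D -> D = f x / x.
Proof.
move=> x0 GD; apply/eqP; rewrite eq_le; apply/andP; split.
  apply/ler_addgt0Pr => e e0.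
  have [r r0 /(_ (r + x))] := GD e e0.
  rewrite addrK gtr0_norm// lexx addr_ge0 ?(ltW r0) ?(ltW x0)// => /(_ isT isT).
  rewrite ler_norml => /andP[h _].
  have := @rate_integral_le_rate x (r + x) x0; rewrite addrK lerDr (ltW r0) => /(_ isT) h2.
  rewrite -(ler_pM2l r0); nra.
apply/ler_addgt0Pr => e e0.
have [r r0 /(_ (x - Num.min r x))] := GD e e0.
set m := Num.min _ _.
have m0 : 0 < m by rewrite lt_min r0.
have mr : m <= r by rewrite ge_min lexx.
have mx : m <= x by rewrite ge_min lexx orbT.
have -> : x - m - x = - m by ring.
rewrite normrN gtr0_norm// subr_ge0 mx => /(_ isT mr).
rewrite ler_norml => /andP[h1 _].
have := @rate_integral_ge (x - m) x; rewrite subr_ge0 => /(_ mx).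
rewrite gerBl (ltW m0) => /(_ isT); have -> : x - (x - m) = m by ring.
move=> h2; rewrite -(ler_pM2l m0); nra.
Qed.

(* The mean value theorem with the sign of the slope fixed by
   [rate_nonincreasing]. *)
Lemma rate_slope h s t : 0 < h -> 0 < s -> s < t ->
    (forall a, s <= a <= t -> derivable f a 1 /\
      h <= 2^-1 * `|a^-1 * (derive1 f a - f a / a)|) ->
  f t / t <= f s / s - 2 * h * (t - s).
Proof.
move=> h0 s0 st fh.
pose df a := a^-1 * (derive1 f a - f a / a).
have dphi a : s <= a <= t -> is_derive a 1 (fun u => f u / u) (df a).
  move=> sat; have [fa _] := fh a sat.
  have a0 : a != 0 by rewrite gt_eqF//; case/andP: sat => sa _; exact: lt_le_trans sa.
  have da : is_derive a 1 f (derive1 f a) by rewrite derive1E; exact/derivableP.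
  have di : is_derive a 1 (fun u : R => u^-1) (- a ^- 2 *: 1).
    exact: (@is_deriveV _ id a 1 1 a0 (is_derive_id _ _)).
  apply: (is_derive_eq (is_deriveM da di)).
  rewrite /df/= /GRing.scale/=; field; exact: a0.
have [||c] := @MVT R (fun u => f u / u) df s t st.
- move=> a; rewrite in_itv/= => /andP[sa at_]; apply: dphi.
  by rewrite !ltW.
- apply: derivable_within_continuous => a; rewrite in_itv/= => sat.
  by have [] := dphi a sat.
rewrite in_itv/= => /andP[sc ct] E.
have [|_ hc] := fh c; first by rewrite (ltW sc) (ltW ct).
have phi_le := rate_nonincreasing s0 (ltW st).
have ts0 : 0 < t - s by rewrite subr_gt0.
have dfc : df c <= 0 by rewrite -(pmulr_lle0 _ ts0) -E subr_le0.
move: hc; rewrite -/(df c) ler0_norm// => hc.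
nra.
Qed.

(** Rates fall with slope at least 2h. Integrating this exactly would give h (y - x)^2; comparing
    rates only at the midpoint avoids that integral and leaves h/4. *)
Lemma strongly_concave_at h m M x y D : 0 < h -> 0 <= m ->
    (forall a, m <= a <= M -> 0 < a -> derivable f a 1 /\
      h <= 2^-1 * `|a^-1 * (derive1 f a - f a / a)|) ->
    is_derive_ge0 G x D -> m <= x <= M -> m <= y <= M ->
  G y - G x <= D * (y - x) - h / 4 * (y - x) ^+ 2.
Proof.
move=> h0 m0 fh GD /andP[mx xM] /andP[my yM].
have slope s t : m <= s -> t <= M -> 0 < s -> s < t ->
    f t / t <= f s / s - 2 * h * (t - s).
  move=> ms tM s0 st; apply: rate_slope => // a /andP[sa at_].
  by apply: fh; [apply/andP; split; lra|lra].
have [xy|yx|<-] := ltgtP x y; last by rewrite !subrr expr0n/= !mulr0 subr0.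
- pose c := (x + y) / 2; pose e := (x + c) / 2.
  have cE : 2 * c = x + y by rewrite /c; field.
  have eE : 2 * e = x + c by rewrite /e; field.
  have x0 : 0 <= x by lra.
  have e1 : f e / e <= D by apply: rate_le_derive x0 GD _; lra.
  have e2 := @slope e c; have {}e2 : f c / c <= f e / e - 2 * h * (c - e).
    by apply: e2; lra.
  have g1 : G c - G x <= (c - x) * D.
    apply: rate_integral_le => //; first lra.
    by move=> t xt _; exact: rate_le_derive x0 GD xt.
  have g2 : G y - G c <= (y - c) * (f c / c) by apply: rate_integral_le_rate; lra.
  have g3 : (y - c) * (f c / c) <= (y - c) * (D - 2 * h * (c - e)).
    by apply: ler_wpM2l; lra.
  have -> : D * (y - x) - h / 4 * (y - x) ^+ 2 =
    (c - x) * D + (y - c) * (D - 2 * h * (c - e)) by rewrite /e /c; field.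
  lra.
(* Here x > 0 and [D] is the rate at [x]. The gain is (h/2)(x - y)^2, and half of it is given away
   to match the other case. *)
- pose c := (x + y) / 2.
  have cE : 2 * c = x + y by rewrite /c; field.
  have x0 : 0 < x by lra.
  have DE := derive_eq_rate x0 GD.
  have e2 := @slope c x; have {}e2 : f x / x <= f c / c - 2 * h * (x - c).
    by apply: e2; lra.
  have g1 : (x - c) * (f x / x) <= G x - G c by apply: rate_integral_ge; lra.
  have g2 : (c - y) * (f c / c) <= G c - G y by apply: rate_integral_ge; lra.
  have g3 : (c - y) * (D + 2 * h * (x - c)) <= (c - y) * (f c / c).
    by apply: ler_wpM2l; rewrite ?DE; lra.
  rewrite -DE in g1.
  have -> : D * (y - x) - h / 4 * (y - x) ^+ 2 =
      - (x - c) * D - (c - y) * (D + 2 * h * (x - c)) + h * (c - y) ^+ 2.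
    by rewrite /c; field.
  have := mulr_ge0 (ltW h0) (sqr_ge0 (c - y)).
  lra.
Qed.

End Productivity1.

(** * Several productivity functions *)

Section Productivities.
Context {R : realType} {N : nat}.
Implicit Types (x y z w : 'rV[R]_N).

Lemma sum_update (F : 'I_N -> R -> R) x i (c : R) :
  \sum_j F j ((x + c *: delta_mx 0 i) 0 j) - \sum_j F j (x 0 j) =
  F i (x 0 i + c) - F i (x 0 i).
Proof.
rewrite -sumrB (bigD1 i)//= big1 => [|j ji].
  by rewrite !mxE !eqxx mulr1 addr0.
by rewrite !mxE eqxx (negbTE ji) mulr0 addr0 subrr.
Qed.

Lemma dotp_delta w (c : R) i : dotp w (c *: delta_mx 0 i) = w 0 i * c.
Proof.
rewrite /dotp (bigD1 i)//= big1 => [|j ji]; rewrite !mxE eqxx ?eqxx.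
  by rewrite mulr1 addr0.
by rewrite (negbTE ji) mulr0 mulr0.
Qed.

Lemma enorm_delta (c : R) (i : 'I_N) :
  enorm (c *: delta_mx 0 i : 'rV[R]_N) = `|c|.
Proof.
by rewrite -sqrtr_sqr /enorm (eq_bigr (fun j => (c *: delta_mx 0 i : 'rV[R]_N) 0 j *
  (c *: delta_mx 0 i : 'rV[R]_N) 0 j))// -/(dotp _ _) dotp_delta !mxE !eqxx mulr1 expr2.
Qed.

Lemma gradient_coord (F : 'I_N -> R -> R) x w i :
    is_gradient (fun b => \sum_j F j (b 0 j)) x w -> (forall j, 0 <= x 0 j) ->
  is_derive_ge0 (F i) (x 0 i) (w 0 i).
Proof.
move=> Fw x0 e e0; have [r r0 h] := Fw e e0; exists r => // z z0 zr.
have /h : forall j, 0 <= (x + (z - x 0 i) *: delta_mx 0 i) 0 j.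
  move=> j; rewrite !mxE eqxx /=; case: (eqVneq j i) => [->|_].
    by rewrite mulr1 addrC subrK.
  by rewrite mulr0 addr0.
rewrite sum_update (addrC x) addrK (addrC (x 0 i)) subrK enorm_delta dotp_delta.
exact.
Qed.

Variable f : 'I_N -> R -> R.
Hypothesis pf : forall i, productivity (f i).

Lemma gradient_strongly_concave (h : R) (Xm Xp : 'I_N -> R) x y w : 0 < h ->
    (forall i, 0 <= Xm i) ->
    (forall i a, Xm i <= a <= Xp i -> 0 < a -> derivable (f i) a 1 /\
      h <= 2^-1 * `|a^-1 * (derive1 (f i) a - f i a / a)|) ->
    (forall i, Xm i <= x 0 i <= Xp i) -> (forall i, Xm i <= y 0 i <= Xp i) ->
    is_gradient (fun b => \sum_i rate_integral (f i) (b 0 i)) x w ->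
  \sum_i rate_integral (f i) (y 0 i) - \sum_i rate_integral (f i) (x 0 i) <=
  dotp w (y - x) - h / 4 * enorm (y - x) ^+ 2.
Proof.
move=> h0 Xm0 fh xB yB Fw.
rewrite enorm_sqr /dotp mulr_sumr -!sumrB; apply: ler_sum => i _.
have x0 j : 0 <= x 0 j by have /andP[+ _] := xB j; apply: le_trans.
have := strongly_concave_at (pf i) h0 (Xm0 i) (fh i)
  (@gradient_coord (fun i => rate_integral (f i)) x w i Fw x0) (xB i) (yB i).
by rewrite !mxE expr2.
Qed.

(* A unit without funds has no output, so [w 0 i] drops out of both sides
   there. *)
Lemma gradient_mean_output x w : (forall i, 0 <= x 0 i) ->
    is_gradient (fun b => \sum_i rate_integral (f i) (b 0 i)) x w ->
  forall i, w 0 i * x 0 i = f i (x 0 i).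
Proof.
move=> x0 Fw i; have [xi0|xi0] := eqVneq (x 0 i) 0.
  by rewrite xi0 mulr0; have [->] := pf i.
rewrite (derive_eq_rate (pf i) _
  (@gradient_coord (fun i => rate_integral (f i)) x w i Fw x0)) ?divfK//.
by rewrite lt_def xi0 x0.
Qed.

(** Each changed coordinate stays between its values in [y] and in [z], so the caps remain
    satisfied. *)
Lemma feasible_transfer (X : R) (Xp : 'I_N -> R) y z i j (s : R) :
    feasible X (fun=> 0) Xp y -> feasible X (fun=> 0) Xp z ->
    0 <= s -> s <= z 0 i - y 0 i -> s <= y 0 j - z 0 j -> i != j ->
  feasible X (fun=> 0) Xp (y - s *: delta_mx 0 j + s *: delta_mx 0 i).
Proof.
move=> [yX yB] [zX zB] s0 si sj ij; split.
  have := sum_update (fun _ t => t) (y - s *: delta_mx 0 j) i s.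
  have := sum_update (fun _ t => t) y j (- s); rewrite scaleNr yX; lra.
move=> l; rewrite !mxE eqxx /=.
have := yB l; have := zB l => /andP[zl1 zl2] /andP[yl1 yl2].
case: (eqVneq l j) => [lj|lj].
  rewrite lj (eq_sym j) (negbTE ij) mulr1 mulr0 addr0; subst l.
  by apply/andP; split; lra.
case: (eqVneq l i) => [li|li]; last by rewrite !mulr0 subr0 addr0; apply/andP.
by subst l; rewrite mulr0 mulr1 subr0; apply/andP; split; lra.
Qed.

(* Move [s] from unit [j] to unit [i] and let [s] tend to 0. *)
Lemma maximizer_rates (X : R) (Xp : 'I_N -> R) y z i j :
    is_maximizer (feasible X (fun=> 0) Xp)
      (fun b => \sum_i rate_integral (f i) (b 0 i)) y ->
    feasible X (fun=> 0) Xp z -> y 0 i < z 0 i -> z 0 j < y 0 j ->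
  f i (z 0 i) / z 0 i * y 0 j <= f j (y 0 j).
Proof.
move=> [yB ymax] zB yz zy.
have ij : i != j by apply: contraTneq zy => <-; rewrite -leNgt ltW.
have zi0 : 0 <= y 0 i by have [_ /(_ i)/andP[]] := yB.
have zj0 : 0 <= z 0 j by have [_ /(_ j)/andP[]] := zB.
set phi := f i (z 0 i) / z 0 i.
have phi0 : 0 <= phi.
  by rewrite divr_ge0 ?productivity_ge0//; exact: le_trans (ltW yz).
(* Unit [i] gains at least s phi and unit [j] loses at most [s] times its rate at y_j - s, so
   optimality of [y] orders these rates; then [f j] at y_j - s is at most its value at y_j. *)
have step s : 0 < s -> s < z 0 i - y 0 i -> s < y 0 j - z 0 j ->
    phi * (y 0 j - s) <= f j (y 0 j).
  move=> s0 si sj.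
  have ys0 : 0 < y 0 j - s by lra.
  have := ymax _ (feasible_transfer yB zB (ltW s0) (ltW si) (ltW sj) ij).
  have := sum_update (fun l => rate_integral (f l)) (y - s *: delta_mx 0 j) i s.
  have := sum_update (fun l => rate_integral (f l)) y j (- s); rewrite scaleNr.
  rewrite !mxE eqxx (negbTE ij) /= mulr0 subr0.
  have g1 := @rate_integral_ge R (f i) (pf i) (y 0 i) (y 0 i + s) zi0.
  have {}g1 : s * phi <= rate_integral (f i) (y 0 i + s) - rate_integral (f i) (y 0 i).
    apply: le_trans (g1 _); last by rewrite lerDl ltW.
    rewrite (addrC _ s) addrK ler_wpM2l ?(ltW s0)//.
    rewrite /phi; apply: (rate_nonincreasing (pf i)); lra.
  have g2 := @rate_integral_le_rate R (f j) (pf j) (y 0 j - s) (y 0 j) ys0.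
  have {}g2 : rate_integral (f j) (y 0 j) - rate_integral (f j) (y 0 j - s) <=
      s * (f j (y 0 j - s) / (y 0 j - s)).
    have -> : s * (f j (y 0 j - s) / (y 0 j - s)) =
      (y 0 j - (y 0 j - s)) * (f j (y 0 j - s) / (y 0 j - s)) by congr (_ * _); ring.
    by apply: g2; lra.
  move=> e1 e2 e3.
  have : s * phi <= s * (f j (y 0 j - s) / (y 0 j - s)) by lra.
  rewrite ler_pM2l// ler_pdivlMr// => /le_trans; apply.
  have [_ fm _ _] := pf j; apply: fm; rewrite ?in_itv/= ?andbT; lra.
apply/ler_addgt0Pr => e e0.
(* Small enough for the transfer and for phi s <= e; the 1 covers phi = 0 and the half makes the
   bounds strict. *)
pose s := Num.min (Num.min (z 0 i - y 0 i) (y 0 j - z 0 j)) (e / (phi + 1)) / 2.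
have c0 : 0 < Num.min (Num.min (z 0 i - y 0 i) (y 0 j - z 0 j)) (e / (phi + 1)).
  by rewrite !lt_min !subr_gt0 yz zy divr_gt0// ltr_wpDl.
have : Num.min (Num.min (z 0 i - y 0 i) (y 0 j - z 0 j)) (e / (phi + 1)) <=
   Num.min (Num.min (z 0 i - y 0 i) (y 0 j - z 0 j)) (e / (phi + 1)) by [].
rewrite !le_min => /andP[/andP[c1 c2] c3].
have s0 : 0 < s by rewrite divr_gt0.
have := step s s0; rewrite {1}/s {1}/s => h.
have {}h : phi * (y 0 j - s) <= f j (y 0 j) by apply: h; lra.
have : s * (phi + 1) <= e.
  rewrite -ler_pdivlMr ?ltr_wpDl//; rewrite /s; lra.
lra.
Qed.

(** Going from [y] to [z] moves funds [m] from the units in [J] to those in [I], and outputs grow by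
    at most [L]. By [maximizer_rates], L y_j <= m f_j(y_j) for j in [J]. Summing over [J], where the
    y_j add up to at least [m] because z >= 0, gives L m <= m times the output at [y], so [L] is at
    most that output. *)
Lemma maximizer_half_optimal (X : R) (Xp : 'I_N -> R) y z :
    is_maximizer (feasible X (fun=> 0) Xp)
      (fun b => \sum_i rate_integral (f i) (b 0 i)) y ->
    feasible X (fun=> 0) Xp z ->
  \sum_i f i (z 0 i) <= 2 * \sum_i f i (y 0 i).
Proof.
move=> ymax zB; have yB := ymax.1.
have y0 i : 0 <= y 0 i by have [_ /(_ i)/andP[]] := yB.
have z0 i : 0 <= z 0 i by have [_ /(_ i)/andP[]] := zB.
have fy0 i : 0 <= f i (y 0 i) by exact: productivity_ge0.
pose I := fun i => y 0 i < z 0 i.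
pose J := fun i => z 0 i < y 0 i.
pose m := \sum_(j | J j) (y 0 j - z 0 j).
have mI : \sum_(i | I i) (z 0 i - y 0 i) = m.
  have : \sum_i (z 0 i - y 0 i) = 0 by rewrite sumrB yB.1 zB.1 subrr.
  rewrite (bigID I)/= [X in _ + X](bigID J)/=.
  rewrite [X in _ + (_ + X)]big1 => [|i /andP[]]; last first.
    rewrite /I /J -!leNgt => h1 h2.
    by apply/eqP; rewrite subr_eq0 eq_le h1 h2.
  rewrite [X in _ + (X + _)](eq_bigl J) => [|i]; last first.
    by rewrite /I /J /=; case: (ltgtP (y 0 i) (z 0 i)).
  rewrite addr0 => /eqP; rewrite addr_eq0 => /eqP ->.
  by rewrite -sumrN; apply: eq_bigr => i _; rewrite opprB.
pose phi i := f i (z 0 i) / z 0 i.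
pose L := \sum_(i | I i) (z 0 i - y 0 i) * phi i.
have step1 : \sum_i f i (z 0 i) <= \sum_i f i (y 0 i) + L.
  rewrite /L [X in _ + X]big_mkcond/= -big_split/=; apply: ler_sum => i _.
  rewrite /I; case: ifPn => [yz|]; last first.
    rewrite -leNgt addr0 => zy; have [_ fm _ _] := pf i.
    by apply: fm; rewrite ?in_itv/= ?z0 ?y0.
  have zp : 0 < z 0 i by exact: le_lt_trans yz.
  have -> : f i (z 0 i) = z 0 i * phi i by rewrite mulrC divfK// gt_eqF.
  have : y 0 i * phi i <= f i (y 0 i).
    have [yi0|yi0] := eqVneq (y 0 i) 0; first by rewrite {1}yi0 mul0r.
    have yp : 0 < y 0 i by rewrite lt_def yi0 y0.
    by rewrite mulrC -ler_pdivlMr//; apply: rate_nonincreasing => //; exact: ltW.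
  lra.
have step2 j : J j -> L * y 0 j <= m * f j (y 0 j).
  move=> Jj; rewrite -mI !mulr_suml; apply: ler_sum => i Ii.
  rewrite -mulrA; apply: ler_wpM2l; first by rewrite subr_ge0; exact: ltW.
  exact: maximizer_rates ymax zB Ii Jj.
have m0 : 0 <= m by apply: sumr_ge0 => j /ltW; rewrite subr_ge0.
have L0 : 0 <= L.
  apply: sumr_ge0 => i Ii; rewrite mulr_ge0 ?subr_ge0 ?divr_ge0 ?productivity_ge0//.
  exact: ltW.
have Lm : L * m <= m * \sum_i f i (y 0 i).
  apply: (@le_trans _ _ (L * \sum_(j | J j) y 0 j)).
    by rewrite ler_wpM2l// ler_sum// => j _; rewrite gerBl.
  apply: (@le_trans _ _ (m * \sum_(j | J j) f j (y 0 j))).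
    by rewrite !mulr_sumr; exact: ler_sum.
  rewrite ler_wpM2l// [leRHS](bigID J)/= lerDl; exact: sumr_ge0.
(* [m] cannot be cancelled if no funds move, but then [L] is 0 as well. *)
have [m00|m00] := eqVneq m 0.
  suff L00 : L = 0.
    have : 0 <= \sum_i f i (y 0 i) by exact: sumr_ge0.
    lra.
  rewrite m00 in mI; apply: big1 => i Ii.
  have /psumr_eq0P : \sum_(i | I i) (z 0 i - y 0 i) = 0 by [].
  by move=> -> //; rewrite ?mul0r// => j /ltW; rewrite subr_ge0.
have mp : 0 < m by rewrite lt_def m00.
by move: Lm; rewrite mulrC ler_pM2l//; lra.
Qed.

End Productivities.

(** * Bounded conditional expectations *)

Section ConditionalExpectation.
Context {d : measure_display} {T : measurableType d} {R : realType}.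
Context {P : probability T R}.
Implicit Types (G : set (set T)) (U V D : T -> R) (M : R).

Lemma ae_notin_of_Rintegral0 U (A : set T) : measurable A ->
    P.-integrable setT (EFin \o U) -> (forall w, A w -> 0 < U w) ->
    \int[P]_(w in A) U w = 0 ->
  \forall w \ae P, ~ A w.
Proof.
move=> mA iU U0 UA.
have iUA : P.-integrable A (EFin \o U) by apply: integrableS iU.
have : (\int[P]_(w in A) `|(U w)%:E| = 0)%E.
  rewrite -(_ : (\int[P]_(w in A) U w)%:E = 0%E); last by rewrite UA.
  rewrite /Rintegral fineK; last exact: integrable_fin_num.
  apply: eq_integral => w; rewrite inE => Aw /=.
  by rewrite ger0_norm// ltW// U0.
move/(ae_eq_integral_abs P mA (measurable_int _ iUA)); apply: filterS => w /= h Aw.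
have := h Aw; rewrite /= => -[Uw0].
by have := U0 _ Aw; rewrite Uw0 ltxx.
Qed.

Lemma cond_expectation_Rintegral G V D A : G `<=` measurable ->
    is_cond_expectation P <<s G >> V D -> <<s G >> A ->
  \int[P]_(w in A) (V w - D w) = 0.
Proof.
move=> GT [iV iD _ VD] GA.
have mA := g_sigma_sub GT GA.
have iVA : P.-integrable A (EFin \o V) by apply: integrableS iV.
have iDA : P.-integrable A (EFin \o D) by apply: integrableS iD.
by rewrite RintegralB// /Rintegral VD// subrr.
Qed.

(** On the event D < -M, which belongs to the sub-sigma-algebra, V - D is positive and yet
    integrates to 0, so the event is null; likewise for D > M. *)
Lemma cond_expectation_bounded G V D M : G `<=` measurable ->
    is_cond_expectation P <<s G >> V D -> (forall w, `|V w| <= M) ->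
  \forall w \ae P, `|D w| <= M.
Proof.
move=> GT VD VM; have [iV iD mD _] := VD.
have gup : <<s G >> [set w | M < D w].
  have := mD `]M, +oo[%classic; rewrite (_ : _ @^-1` _ = [set w | M < D w]).
    by apply; exact: measurable_itv.
  by apply/seteqP; split=> w /=; rewrite in_itv/= andbT.
have glo : <<s G >> [set w | D w < - M].
  have := mD `]-oo, (- M)[%classic; rewrite (_ : _ @^-1` _ = [set w | D w < - M]).
    by apply; exact: measurable_itv.
  by apply/seteqP; split=> w /=; rewrite in_itv/=.
have iVD : P.-integrable setT (EFin \o (fun w => V w - D w)).
  exact: (integrableB measurableT iV iD).
have iDV : P.-integrable setT (EFin \o (fun w => D w - V w)).
  exact: (integrableB measurableT iD iV).
have h1 : \forall w \ae P, ~ [set w | D w < - M] w.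
  apply: (ae_notin_of_Rintegral0 (g_sigma_sub GT glo) iVD).
    by move=> w /=; have := VM w; rewrite ler_norml => /andP[? ?] ?; lra.
  exact: cond_expectation_Rintegral VD glo.
have h2 : \forall w \ae P, ~ [set w | M < D w] w.
  apply: (ae_notin_of_Rintegral0 (g_sigma_sub GT gup) iDV).
    by move=> w /=; have := VM w; rewrite ler_norml => /andP[? ?] ?; lra.
  have := cond_expectation_Rintegral GT VD gup => VD0.
  have mA := g_sigma_sub GT gup.
  have iVDA : P.-integrable [set w | M < D w] (EFin \o (fun w => V w - D w)).
    by apply: integrableS iVD.
  rewrite -[RHS](mulr0 (-1)) -VD0 -RintegralZl//.
  by apply: eq_Rintegral => w _; rewrite mulN1r opprB.
apply: filterS2 h1 h2 => w /= /negP + /negP; rewrite -!leNgt => ? ?.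
by rewrite ler_norml; apply/andP.
Qed.

(** Clipping a conditional expectation yields a version bounded at every outcome and still
    measurable for the past. The orthogonality and strong law arguments ask for bounds everywhere,
    not just almost surely. *)
Definition clip M (a : R) : R := Num.max (- M) (Num.min M a).

Lemma clip_le M a : 0 <= M -> `|clip M a| <= M.
Proof.
move=> M0; rewrite /clip ler_norml le_max lexx/= ge_max ge_min lexx andbT.
lra.
Qed.

Lemma clip_id M a : `|a| <= M -> clip M a = a.
Proof.
by rewrite ler_norml /clip => /andP[h1 h2]; rewrite min_r// max_r.
Qed.

Lemma g_measurable_clip G M D : g_measurable G D ->
  g_measurable G (fun w => clip M (D w)).
Proof.
move=> gD; apply: measurable_maxr => //.
exact: measurable_minr.
Qed.

Lemma clip_cond_expectation G V D M : G `<=` measurable ->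
    is_cond_expectation P <<s G >> V D -> (forall w, `|V w| <= M) ->
  [/\ \forall w \ae P, clip M (D w) = D w,
      g_measurable G (fun w => clip M (D w)),
      P.-integrable setT (EFin \o (fun w => V w - clip M (D w))) &
      forall A, <<s G >> A -> \int[P]_(w in A) (V w - clip M (D w)) = 0].
Proof.
move=> GT VD VM; have [iV iD mD _] := VD.
have M0 : 0 <= M by exact: le_trans (VM point).
have ae : \forall w \ae P, clip M (D w) = D w.
  by apply: filterS (cond_expectation_bounded GT VD VM) => w; exact: clip_id.
have gD : g_measurable G D.
  by move=> _ S mS; rewrite setTI; exact: mD.
have gc := g_measurable_clip M gD.
have mc := g_measurableW GT gc.
have ic : P.-integrable setT (EFin \o (fun w => clip M (D w))).
  by apply: (integrable_bounded (M := M)) => // w; exact: clip_le.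
have iVc : P.-integrable setT (EFin \o (fun w => V w - clip M (D w))).
  exact: (integrableB measurableT iV ic).
split=> // A GA; rewrite -(cond_expectation_Rintegral GT VD GA).
have mA := g_sigma_sub GT GA.
have iVD : P.-integrable setT (EFin \o (fun w => V w - D w)).
  exact: (integrableB measurableT iV iD).
congr fine; apply: ae_eq_integral => //.
- by apply: measurable_int; apply: integrableS iVc.
- by apply: measurable_int; apply: integrableS iVD.
- by apply: filterS ae => w -> _.
Qed.

End ConditionalExpectation.

(** * The average rates scheme *)

Section Scheme.
Context {d : measure_display} {T : measurableType d} {R : realType}.
Context {P : probability T R} {N : nat}.
Variables (g : 'I_N -> R -> nat -> {RV P >-> R}) (B : set 'rV[R]_N).
Variables (eps : R) (x0 : 'rV[R]_N) (x v : nat -> T -> 'rV[R]_N).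
Hypothesis Bx0 : B x0.
Hypothesis cB : convex_budgets B.
Hypothesis scheme : average_rates_scheme g B eps x0 x v.

(** The generators of [past]: [past g x v k] is convertible to the sigma-algebra generated by
    [outcomes k], so the lemmas on generated sigma-algebras apply to it. *)
Definition outcomes (k : nat) : set (set T) :=
  [set A | exists j i (S : set R), [/\ (j < k)%N, measurable S &
         A = (fun w => v j w 0 i) @^-1` S \/
         A = (fun w => g i (x j w 0 i) j w) @^-1` S]].

Lemma outcomes_sub j k : (j <= k)%N -> outcomes j `<=` outcomes k.
Proof.
by move=> jk A [l [i [S [lj mS AE]]]]; exists l, i, S; split=> //; exact: leq_trans jk.
Qed.

Lemma scheme_feasible k w : B (x k w).
Proof. by have [s0 _ s2] := scheme; case: k => [|k]; [rewrite s0|have [] := s2 k w]. Qed.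

(** For an unfunded unit both sides are 0, whatever its unspecified rate. *)
Lemma output_eq_rateM k w i : g i (x k w 0 i) k w = v k w 0 i * x k w 0 i.
Proof.
have [_ /(_ k w i) + _] := scheme; rewrite /is_rate; case: eqP => [-> ->|x_neq0 ->].
  by rewrite mulr0.
by rewrite divfK//; exact/eqP.
Qed.

Lemma gtot_eq_dotp k w : gtot g (x k w) k w = dotp (v k w) (x k w).
Proof. by apply: eq_bigr => i _; exact: output_eq_rateM. Qed.

Lemma g_measurable_rate j k i : (j < k)%N ->
  g_measurable (outcomes k) (fun w => v j w 0 i).
Proof.
move=> jk _ S mS; rewrite setTI; apply: sub_sigma_algebra.
by exists j, i, S; split=> //; left.
Qed.

(** The next budget is a nonexpansive function of x^k + eps v^k, which inductively depends only on
    terms up to k. *)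
Lemma g_measurable_budget k i : g_measurable (outcomes k) (fun w => x k w 0 i).
Proof.
have [s0 _ s2] := scheme.
elim: k i => [|k IH] i.
  rewrite (_ : (fun _ => _) = cst (x0 0 i)); first exact: measurable_cst.
  by apply/funext => w /=; rewrite s0.
apply: (@measurable_fun_lipschitz _ (g_sigma_algebraType (outcomes k.+1)) R N
  (fun w => x k w + eps *: v k w)).
  move=> l; rewrite (_ : (fun _ => _) = (fun w => x k w 0 l + eps * v k w 0 l)).
    apply: measurable_funD.
      exact: g_measurable_sub (outcomes_sub (leqnSn k)) (IH l).
    apply: measurable_funM => //; exact: g_measurable_rate.
  by apply/funext => w; rewrite !mxE.
move=> w w'; apply: le_trans (proj_nonexpansive cB (s2 k w) (s2 k w')).
have := coord_le_enorm (x k.+1 w - x k.+1 w') i.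
by rewrite !mxE.
Qed.

Hypothesis mv : forall k i, measurable_fun setT (fun w => v k w 0 i).

(** [g] is measurable in the outcome for fixed funds only, while outputs are taken at random funds.
    They are measurable as products of rate and budget, the budget of term j being so once
    [outcomes j] is known to be measurable; hence the strong induction. *)
Lemma outcomes_measurable k : outcomes k `<=` measurable.
Proof.
have [n] := ubnP k; elim: n k => // n IH k kn A [j [i [S [jk mS AE]]]].
have mx : measurable_fun setT (fun w => x j w 0 i).
  have oj : outcomes j `<=` measurable by apply: IH; exact: leq_trans jk kn.
  exact (g_measurableW oj (g_measurable_budget i)).
case: AE => ->; first by rewrite -[X in measurable X]setTI; exact: mv.
under eq_fun do rewrite output_eq_rateM.
by rewrite -[X in measurable X]setTI; apply: measurable_funM.
Qed.

Variables (M : R) (D : nat -> T -> 'rV[R]_N).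
Hypothesis vM : forall k w, enorm (v k w) <= M.
Hypothesis vD : forall k i, is_cond_expectation P (past g x v k)
  (fun w => v k w 0 i) (fun w => D k w 0 i).

Let vD' k i : is_cond_expectation P <<s outcomes k >>
  (fun w => v k w 0 i) (fun w => D k w 0 i) := vD k i.

Let vM' k i w : `|v k w 0 i| <= M.
Proof. exact: le_trans (coord_le_enorm _ _) (vM k w). Qed.

Lemma ae_clip_id : \forall w \ae P, forall k i, clip M (D k w 0 i) = D k w 0 i.
Proof.
apply: ae_foralln => k.
have : \forall w \ae P, forall n (i : 'I_N), i = n :> nat ->
    clip M (D k w 0 i) = D k w 0 i.
  apply: ae_foralln => n; have [nN|Nn] := ltnP n N; last first.
    by apply: nearW => w i iE; move: Nn; rewrite -iE leqNgt ltn_ord.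
  have [+ _ _ _] := clip_cond_expectation (@outcomes_measurable k)
    (vD' k (Ordinal nN)) (vM' k (Ordinal nN)).
  by apply: filterS => w Dw i iE; rewrite (_ : i = Ordinal nN)//; exact: val_inj.
by apply: filterS => w h i; exact: h.
Qed.

(** Martingale differences are orthogonal: for i < j the i-th summand and u^j are determined by the
    past of term j and bounded, whereas the centred rates of term j integrate to 0 over every event
    of that past. *)
Lemma vanishing_rate_noise (u : nat -> T -> 'rV[R]_N) (K : R) :
    (forall k i, g_measurable (outcomes k) (fun w => u k w 0 i)) ->
    (forall k w i, `|u k w 0 i| <= K) ->
  vanishing P (fun k w => `|avg (fun j =>
    \sum_i (v j w 0 i - clip M (D j w 0 i)) * u j w 0 i) k|).
Proof.
move=> gu uK; pose U k i w : R := v k w 0 i - clip M (D k w 0 i).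
have UP k i := clip_cond_expectation (@outcomes_measurable k) (vD' k i) (vM' k i).
have mU k i : measurable_fun setT (U k i).
  by have [_ _ iU _] := UP k i; apply/measurable_EFinP; exact: measurable_int iU.
have gU j k i : (j < k)%N -> g_measurable (outcomes k) (U j i).
  move=> jk; apply: measurable_funB; first exact: g_measurable_rate.
  have [_ gc _ _] := UP j i.
  exact: g_measurable_sub (outcomes_sub (ltnW jk)) gc.
have M0 : 0 <= M by exact: le_trans (enorm_ge0 _) (vM 0 point).
have U_le k i w : `|U k i w| <= 2 * M.
  apply: le_trans (ler_normB _ _) _.
  have := vM' k i w; have := clip_le (D k w 0 i) M0; lra.
pose xi j w := \sum_i U j i w * u j w 0 i.
have mu k i := g_measurableW (@outcomes_measurable k) (gu k i).
have mxi j : measurable_fun setT (xi j).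
  by apply: measurable_sum => i; exact: measurable_funM.
have xi_le j w : `|xi j w| <= \sum_(i < N) 2 * M * K.
  rewrite (le_trans (ler_norm_sum _ _ _))// ler_sum// => i _.
  by rewrite normrM ler_pM.
apply: (vanishing_avg mxi xi_le) => i j ij.
have gxi : g_measurable (outcomes j) (xi i).
  apply: (@measurable_sum _ (g_sigma_algebraType (outcomes j))) => l.
  apply: measurable_funM; first exact: gU.
  exact: g_measurable_sub (outcomes_sub (ltnW ij)) (gu i l).
have iF m : P.-integrable setT
    (EFin \o (fun w => U j m w * (u j w 0 m * xi i w))).
  have [_ _ iU _] := UP j m.
  apply: (integrable_mul_bounded (M := K * \sum_(i < N) 2 * M * K) iU) => [|w].
    exact: measurable_funM.
  by rewrite normrM ler_pM.
have [_ sF] := Rintegral_sum (index_enum 'I_N) iF.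
rewrite (_ : (fun _ => _) = (fun w => \sum_m U j m w * (u j w 0 m * xi i w))).
  rewrite sF big1// => m _; have [_ _ iU U0] := UP j m.
  apply: (Rintegral_orthogonal (M := K * \sum_(i < N) 2 * M * K)
    (@outcomes_measurable j) iU U0) => [|w].
    by apply: measurable_funM; [exact: gu|exact: gxi].
  by rewrite normrM ler_pM.
apply/funext => w; rewrite mulrC /xi mulr_suml.
by apply: eq_bigr => m _; rewrite mulrA.
Qed.

End Scheme.

(** * Averages *)

Section Averages.
Context {R : realType}.
Implicit Types (u p dist xi : nat -> R) (k : nat).

Lemma ler_avg u p k : (forall j, u j <= p j) -> avg u k <= avg p k.
Proof. by move=> up; rewrite ler_wpM2l ?invr_ge0// ler_sum. Qed.

Lemma avgD u p k : avg (fun j => u j + p j) k = avg u k + avg p k.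
Proof. by rewrite /avg big_split mulrDr. Qed.

Lemma avgZ (c : R) u k : avg (fun j => c * u j) k = c * avg u k.
Proof. by rewrite /avg -mulr_sumr mulrCA. Qed.

Lemma avgN u k : avg (fun j => - u j) k = - avg u k.
Proof. by rewrite /avg sumrN mulrN. Qed.

Lemma avg_cst (c : R) k : (0 < k)%N -> avg (fun=> c) k = c.
Proof.
move=> k0; rewrite /avg sumr_const card_ord -[c *+ k]mulr_natl mulKf//.
by rewrite pnatr_eq0 -lt0n.
Qed.

Lemma ler_norm_avg u k : `|avg u k| <= avg (fun j => `|u j|) k.
Proof.
rewrite /avg normrM ger0_norm ?invr_ge0// ler_wpM2l ?invr_ge0//.
exact: ler_norm_sum.
Qed.

Lemma avg_telescope (a p : nat -> R) (eps E : R) k : 0 < eps ->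
    (forall j, 0 <= a j) -> (forall j, 2 * eps * p j <= a j - a j.+1 + E) ->
    (0 < k)%N ->
  avg p k <= a 0%N / (2 * eps * k%:R) + E / (2 * eps).
Proof.
move=> eps0 a0 pa k0; have k0' : 0 < k%:R :> R by rewrite ltr0n.
have S n : 2 * eps * \sum_(j < n) p j <= a 0%N - a n + E * n%:R.
  elim: n => [|n IH]; first by rewrite big_ord0 !mulr0 addr0 subrr.
  rewrite big_ord_recr/= mulrDr -natr1; have := pa n; lra.
have h := S k; have ak := a0 k.
rewrite -(ler_pM2l (mulr_gt0 (mulr_gt0 (ltr0n _ 2) eps0) k0')).
have -> : 2 * eps * k%:R * avg p k = 2 * eps * \sum_(j < k) p j.
  by rewrite /avg mulrA mulfK// gt_eqF.
have -> : 2 * eps * k%:R * (a 0%N / (2 * eps * k%:R) + E / (2 * eps)) =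
    a 0%N + E * k%:R.
  by field; rewrite !gt_eqF.
lra.
Qed.

(** Telescoping bounds the average of [p] by (1 + A) s^2, so squared distances are O(s^2) up to
    noise. Jensen would put the noise under a square root; the tangent bound at [s] keeps it linear,
    at the price of a factor 1/s. *)
Lemma avg_dist_le dist p xi (s eps E A kappa : R) k :
    0 < s -> 0 < eps -> 0 < kappa -> (0 < k)%N ->
    (forall j, kappa * dist j ^+ 2 <= p j - xi j) ->
    (forall j, 2 * eps * p j <= dist j ^+ 2 - dist j.+1 ^+ 2 + E) ->
    dist 0%N ^+ 2 / (2 * eps * k%:R) <= s ^+ 2 -> E / (2 * eps) <= A * s ^+ 2 ->
  avg dist k <= (2^-1 + (1 + A) / (2 * kappa)) * s +
                (2 * kappa * s)^-1 * `|avg xi k|.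
Proof.
move=> s0 eps0 ka0 k0 sc pE d0 EA.
have pk := avg_telescope eps0 (fun j => sqr_ge0 (dist j)) pE k0.
have d2 : kappa * avg (fun j => dist j ^+ 2) k <= (1 + A) * s ^+ 2 + `|avg xi k|.
  rewrite -avgZ; apply: (le_trans (ler_avg k sc)).
  have -> : avg (fun j => p j - xi j) k = avg p k - avg xi k.
    by rewrite avgD avgN.
  have := ler_norm (- avg xi k); rewrite normrN; lra.
(* AM-GM: [dist <= (s + dist^2 / s) / 2] *)
have amgm j : dist j <= s / 2 + (2 * s)^-1 * dist j ^+ 2.
  rewrite -subr_ge0.
  have -> : s / 2 + (2 * s)^-1 * dist j ^+ 2 - dist j =
    (dist j - s) ^+ 2 / (2 * s) by field; rewrite gt_eqF.
  by rewrite divr_ge0 ?sqr_ge0 ?mulr_ge0// ltW.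
apply: (le_trans (ler_avg k amgm)).
rewrite avgD avg_cst// avgZ.
have -> : (2^-1 + (1 + A) / (2 * kappa)) * s + (2 * kappa * s)^-1 * `|avg xi k| =
    s / 2 + (2 * s)^-1 * (((1 + A) * s ^+ 2 + `|avg xi k|) / kappa).
  by field; rewrite !gt_eqF.
rewrite lerD2l; apply: ler_wpM2l; first by rewrite invr_ge0 mulr_ge0 ?(ltW s0).
by rewrite ler_pdivlMr// mulrC.
Qed.

(** The learning rate makes eps^2 Gam^2 = delta^2 + 2 r delta, of the size of the drift terms. The
    numerator is then at most 3 (eps Gam)^2, and dividing by 2 eps leaves (3/2) Gam (eps Gam). *)
Lemma learning_rate_error (delta r Gam eps : R) : 0 < delta -> delta <= 1 ->
    0 <= r -> 0 < Gam -> 0 < eps ->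
    eps = Num.sqrt delta * Num.sqrt (delta + 2 * r) / Gam ->
  (eps ^+ 2 * Gam ^+ 2 + delta ^+ 2 + 4 * r * delta) / (2 * eps) <=
  3 / 2 * Gam * Num.sqrt (1 + 2 * r) * Num.sqrt delta.
Proof.
move=> d0 d1 r0 G0 e0 eE.
pose q := eps * Gam.
have qE : q = Num.sqrt delta * Num.sqrt (delta + 2 * r).
  by rewrite /q eE divfK// gt_eqF.
have q0 : 0 < q by rewrite mulr_gt0.
have q2 : q ^+ 2 = delta * (delta + 2 * r).
  by rewrite qE exprMn !sqr_sqrtr; lra.
have qle : q <= Num.sqrt (1 + 2 * r) * Num.sqrt delta.
  rewrite qE mulrC ler_wpM2r ?sqrtr_ge0// ler_sqrt; lra.
apply: (@le_trans _ _ (3 / 2 * Gam * q)).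
  rewrite ler_pdivrMr ?mulr_gt0// -exprMn -/q.
  have -> : 3 / 2 * Gam * q * (2 * eps) = 3 * q ^+ 2 by rewrite /q; field.
  rewrite q2; nra.
by rewrite -[leRHS]mulrA ler_wpM2l// mulr_ge0// ltW.
Qed.

Lemma powR_quarter_sqr (delta : R) : 0 <= delta ->
  (delta `^ 4^-1) ^+ 2 = Num.sqrt delta.
Proof.
move=> d0; rewrite -powR_mulrn ?powR_ge0// -powRrM -powR12_sqrt//.
by congr (_ `^ _); field.
Qed.

End Averages.

(** * Mean total outputs *)

Section MeanOutput.
Context {d : measure_display} {T : measurableType d} {R : realType}.
Context {P : probability T R} {N : nat}.
Variable g : 'I_N -> R -> nat -> {RV P >-> R}.
Implicit Types (b c : 'rV[R]_N).
Hypothesis gi : forall i k a, 0 <= a -> P.-integrable setT (EFin \o g i a k).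

Lemma gtot_mean_Rintegral b k : (forall i, 0 <= b 0 i) ->
  P.-integrable setT (EFin \o gtot g b k) /\
  gtot_mean g b k = \int[P]_w gtot g b k w.
Proof.
move=> b0.
have [h1 h2] := Rintegral_sum (index_enum 'I_N) (fun i => gi i k (b0 i)).
split=> //; rewrite /gtot h2; apply: eq_bigr => i _.
by rewrite /gbar expectation_def.
Qed.

(** Hypothesis (ii) holds for every outcome, so integrating it at two fixed budgets transfers it to
    the means; it will be applied at x^j with the outcome frozen. *)
Lemma gtot_mean_lipschitz (gam : R) b c k : 0 < gam -> (forall i, 0 <= b 0 i) ->
    (forall i, 0 <= c 0 i) ->
    (forall w, gam * `|gtot g b k w - gtot g c k w| <= enorm (b - c)) ->
  gam * `|gtot_mean g b k - gtot_mean g c k| <= enorm (b - c).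
Proof.
move=> gam0 b0 c0 bc.
have [ib ->] := gtot_mean_Rintegral k b0; have [ic ->] := gtot_mean_Rintegral k c0.
have ibc : P.-integrable setT (EFin \o (fun w => gtot g b k w - gtot g c k w)).
  exact: (integrableB measurableT ib ic).
rewrite -RintegralB// mulrC -ler_pdivlMr//.
apply: (le_trans (le_normr_Rintegral measurableT ibc)).
have icst : P.-integrable setT (EFin \o cst (enorm (b - c) / gam)).
  apply: (integrable_bounded (M := `|enorm (b - c) / gam|)) => // w.
apply: (@le_trans _ _ (\int[P]_w (cst (enorm (b - c) / gam) w))).
  apply: le_Rintegral => //.
    by have := integrable_abse ibc; apply: eq_integrable.
  by move=> w _; rewrite ler_pdivlMr// mulrC.
rewrite Rintegral_cst// [X in fine X](_ : _ = 1%E) ?mulr1//.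
exact: probability_setT.
Qed.

End MeanOutput.

(* The last summand is for [delta > 1], where the distance is bounded by the
   diameter of the feasible set. *)
Definition tracking_constant {R : realType} (h Gam rad : R) : R :=
  2^-1 + (1 + 3 / 2 * Gam * Num.sqrt (1 + 2 * rad)) / (2 * (h / 4)) + 2 * `|rad|.

Lemma tracking_constant_gt0 {R : realType} (h Gam rad : R) : 0 < h -> 0 < Gam ->
  0 < tracking_constant h Gam rad.
Proof.
move=> h0 G0; rewrite ltr_wpDr ?mulr_ge0// ltr_wpDr//.
by rewrite divr_ge0 ?addr_ge0 ?mulr_ge0 ?sqrtr_ge0 ?divr_ge0// ltW.
Qed.

(** * Distance to the maximizers along a single outcome *)

Section Tracking.
Context {R : realType} {N : nat}.

(** A deterministic statement: all sequences are those of one outcome, and randomness survives only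
    in the averaged noise on the right. *)
Lemma tracking_error (h Gam rad X delta eps : R) (Xm Xp : 'I_N -> R)
    (f : nat -> 'I_N -> R -> R) (x y v D : nat -> 'rV[R]_N) :
    let B := feasible X Xm Xp in
    let s := delta `^ 4^-1 in
    0 < h -> 0 < Gam -> 0 < delta -> 0 < eps ->
    eps = Num.sqrt delta * Num.sqrt (delta + 2 * rad) / Gam ->
    in_ball_of_radius B rad -> (forall i, 0 <= Xm i) ->
    (forall k i, productivity (f k i)) ->
    (forall k i a, Xm i <= a <= Xp i -> 0 < a -> derivable (f k i) a 1 /\
      h <= 2^-1 * `|a^-1 * (derive1 (f k i) a - f k i a / a)|) ->
    (forall k, B (x k)) ->
    (forall k, is_proj B (x k + eps *: v k) (x k.+1)) ->
    (forall k, enorm (v k) <= Gam) ->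
    (forall k, is_maximizer B (fun b => \sum_i rate_integral (f k i) (b 0 i)) (y k)) ->
    (forall k, enorm (y k - y k.+1) <= delta) ->
    (forall k, is_gradient (fun b => \sum_i rate_integral (f k i) (b 0 i)) (x k) (D k)) ->
  forall k, (Num.bound ((2 * rad) ^+ 2 / (2 * eps * s ^+ 2)) < k)%N ->
  avg (fun j => enorm (x j - y j)) k <= tracking_constant h Gam rad * s +
    (2 * (h / 4) * s)^-1 * `|avg (fun j => dotp (v j - D j) (y j - x j)) k|.
Proof.
move=> B s h0 G0 d0 eps0 epsE ballB Xm0 pf fh xB xP vG ymax yd xD k kK.
have s0 : 0 < s by rewrite powR_gt0.
have k0 : (0 < k)%N by exact: leq_ltn_trans kK.
have yB j : B (y j) by have [] := ymax j.
have diam j : enorm (x j - y j) <= 2 * rad by exact: in_ball_diameter ballB (xB j) (yB j).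
have rad0 : 0 <= rad by have := enorm_ge0 (x 0%N - y 0%N); have := diam 0%N; lra.
have ka0 : 0 < h / 4 by rewrite divr_gt0.
have A0 : 0 <= 3 / 2 * Gam * Num.sqrt (1 + 2 * rad).
  by rewrite !mulr_ge0 ?sqrtr_ge0 ?divr_ge0// ltW.
have noise0 : 0 <= (2 * (h / 4) * s)^-1 * `|avg (fun j => dotp (v j - D j) (y j - x j)) k|.
  by rewrite mulr_ge0// invr_ge0 !mulr_ge0// ltW.
rewrite /tracking_constant (ger0_norm rad0) mulrDl.
have [d1|d1] := leP delta 1; last first.
  have s1 : 1 <= s by rewrite -(powRr0 delta) ler_powR ?invr_ge0//; exact: ltW.
  have : avg (fun j => enorm (x j - y j)) k <= 2 * rad.
    by rewrite -(avg_cst (2 * rad) k0); exact: ler_avg.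
  have : 0 <= (2^-1 + (1 + 3 / 2 * Gam * Num.sqrt (1 + 2 * rad)) / (2 * (h / 4))) * s.
    by rewrite mulr_ge0 ?(ltW s0)// addr_ge0// divr_ge0 ?addr_ge0// mulr_ge0// ltW.
  have : 2 * rad <= 2 * rad * s by rewrite ler_peMr// mulr_ge0.
  lra.
have : 0 <= 2 * rad * s by rewrite !mulr_ge0// ltW.
suff : avg (fun j => enorm (x j - y j)) k <=
    (2^-1 + (1 + 3 / 2 * Gam * Num.sqrt (1 + 2 * rad)) / (2 * (h / 4))) * s +
    (2 * (h / 4) * s)^-1 * `|avg (fun j => dotp (v j - D j) (y j - x j)) k|.
  lra.
apply: (avg_dist_le (p := fun j => dotp (v j) (y j - x j)) s0 eps0 ka0 k0
  (E := eps ^+ 2 * Gam ^+ 2 + delta ^+ 2 + 4 * rad * delta)).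
(* Removing the noise from [v j] leaves [D j]; since [y j] is a maximizer, strong concavity at [x j]
   gives 0 <= D.(y - x) - (h/4)|y - x|^2. *)
- move=> j; rewrite (dotpDl (v j)) dotpNl opprD opprK addNKr.
  have iB z : B z -> forall i, Xm i <= z 0 i <= Xp i by case.
  have := gradient_strongly_concave (pf j) h0 Xm0 (fh j) (iB _ (xB j)) (iB _ (yB j)) (xD j).
  by have := (ymax j).2 _ (xB j); rewrite (enormB (x j)); lra.
- move=> j; apply: (proj_step (@feasible_convex R N X Xm Xp) ballB (yB j) (yB j.+1)) => //.
  exact: ltW.
(* The initial squared distance is at most (2 rad)^2; the lower bound on [k] brings its share of the
   average below s^2. *)
- rewrite ler_pdivrMr ?mulr_gt0 ?ltr0n//.
  apply: (@le_trans _ _ ((2 * rad) ^+ 2)).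
    by rewrite ler_pXn2r ?nnegrE ?enorm_ge0 ?mulr_ge0.
  have -> : s ^+ 2 * (2 * eps * k%:R) = k%:R * (2 * eps * s ^+ 2) by ring.
  rewrite -ler_pdivrMr ?mulr_gt0 ?exprn_gt0//; apply: ltW.
  apply: (lt_trans (archi_boundP _)); last by rewrite ltr_nat.
  by rewrite divr_ge0 ?sqr_ge0 ?mulr_ge0 ?exprn_ge0// ltW.
- rewrite (powR_quarter_sqr (ltW d0)).
  exact: learning_rate_error.
Qed.

End Tracking.

Theorem mainTheorem4 (R : realType) (h gam Gam rad : R)
    (h_gt0 : 0 < h) (gam_gt0 : 0 < gam) (Gam_gt0 : 0 < Gam) :
  exists2 C : R, 0 < C &
  forall (d : measure_display) (T : measurableType d) (P : probability T R)
    (N : nat) (X : R) (Xm Xp : 'I_N -> R)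
    (g : 'I_N -> R -> nat -> {RV P >-> R})
    (y : nat -> 'rV[R]_N) (delta eps : R)
    (x0 : 'rV[R]_N) (x v : nat -> T -> 'rV[R]_N),
  let B := feasible X Xm Xp in
  (1 <= N)%N -> 0 < X -> (forall i, 0 <= Xm i <= Xp i) ->
  B !=set0 -> in_ball_of_radius B rad ->
  (forall i k a, 0 <= a -> P.-integrable setT (EFin \o g i a k)) ->
  (forall i k, gbar g i k 0 = 0) ->
  (forall i k, {in `[0, +oo[ &, {homo gbar g i k : a b / a <= b}}) ->
  (forall i k,
    convex_function (`[0, +oo[%classic : set R) (fun a => - gbar g i k a)) ->
  (forall i k a, 0 <= a -> lebesgue_measure.-integrable `[0, a]
                             (EFin \o (fun t => gbar g i k t / t))) ->
  (forall k, is_maximizer B (fun b => Gmean g b k) (y k)) ->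
  0 < delta ->
  (forall k, enorm (y k - y k.+1) <= delta) ->
  0 < eps ->
  eps = Num.sqrt delta * Num.sqrt (delta + 2 * rad) / Gam ->
  B x0 ->
  average_rates_scheme g B eps x0 x v ->
  (* (i) *)
  (forall i k a, Xm i <= a <= Xp i -> 0 < a ->
    derivable (gbar g i k) a 1 /\
    h <= 2^-1 * `|a^-1 * (derive1 (gbar g i k) a - gbar g i k a / a)|) ->
  (* (ii) *)
  (forall k b c w, B b -> B c ->
    gam * `|gtot g b k w - gtot g c k w| <= enorm (b - c)) ->
  (* (iii) *)
  (forall k w, enorm (v k w) <= Gam) ->
  (* (iv) *)
  (forall k, exists D : T -> 'rV[R]_N,
    (forall w, is_gradient (fun b => Gmean g b k) (x k w) (D w)) /\
    (forall i, is_cond_expectation P (past g x v k)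
                 (fun w => v k w 0 i) (fun w => D w 0 i))) ->
  (* difference, absolute difference and difference with the mean *)
  let diff w j : R := gtot g (y j) j w - gtot g (x j w) j w in
  let adiff w j : R := `|gtot g (x j w) j w - gtot g (y j) j w| in
  let mdiff w j : R := gtot g (x j w) j w - gtot_mean g (y j) j in
  (* difference with half of the optimal productivity *)
  let hdiff w j : R := gtot g (x j w) j w - 2^-1 * optimal_productivity g B j in
  let bound (theta : R) : R := C * (delta `^ (4^-1) / theta) in
  (exists K : nat, forall k, (K <= k)%N -> forall theta : R, 0 < theta ->
    [/\ ((1 - bound theta)%:E <= P [set w | (avg (adiff w) k <= theta)%R])%E,
        ((1 - bound theta)%:E <= P [set w | (`|avg (mdiff w) k| <= theta)%R])%E &
        (forall i, Xm i = 0) ->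
        ((1 - bound theta)%:E <= P [set w | (- theta <= avg (hdiff w) k)%R])%E])
  /\
  (forall theta : R, 0 < theta ->
    [/\ (P [set w | theta%:E <= limn_esup (fun k => `|avg (diff w) k|%R%:E)]
         <= P [set w | theta%:E <= limn_esup (fun k => (avg (adiff w) k)%:E)])%E,
        (P [set w | theta%:E <= limn_esup (fun k => (avg (adiff w) k)%:E)]
         <= (bound theta)%:E)%E,
        (P [set w | theta%:E <= limn_esup (fun k => `|avg (mdiff w) k|%R%:E)]
         <= (bound theta)%:E)%E &
        (forall i, Xm i = 0) ->
        (P [set w | limn_einf (fun k => (avg (hdiff w) k)%:E) <= (- theta)%:E]
         <= (bound theta)%:E)%E]).
Proof.
have c0 := tracking_constant_gt0 rad h_gt0 Gam_gt0.
set c := tracking_constant h Gam rad in c0.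
(* 1/gam converts distances into outputs by (ii); the 2 is the one lost in
   [prob_le_of_vanishing]. *)
exists (2 * (c / gam)); first by rewrite mulr_gt0 ?divr_gt0.
move=> d T P N X Xm Xp g y delta eps x0 x v B N0 X0 XmXp Bn0 ballB gi g0 gm gc
  gint ymax d0 yd eps0 epsE Bx0 scheme fh glip vG condD diff adiff mdiff hdiff bound.
pose s := delta `^ 4^-1.
have s0 : 0 < s by rewrite powR_gt0.
have pf k i : productivity (gbar g i k) by split; [exact: g0|exact: gm|exact: gc|exact: gint].
have cB : convex_budgets B := @feasible_convex R N X Xm Xp.
have xB := scheme_feasible Bx0 scheme.
have Xm0 i : 0 <= Xm i by have /andP[] := XmXp i.
have B0 b : B b -> forall i, 0 <= b 0 i.
  by move=> [_ bB] i; have /andP[+ _] := bB i; exact: le_trans (Xm0 i).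
have yB k : B (y k) by have [] := ymax k.
have /choice[D DP] := condD.
have vD k i : is_cond_expectation P (past g x v k) (fun w => v k w 0 i)
    (fun w => D k w 0 i) by have [_ hD] := DP k; exact: hD.
have gradD k w : is_gradient (fun b => \sum_i rate_integral (gbar g i k) (b 0 i))
    (x k w) (D k w) by have [hD _] := DP k; exact: hD.
have mv k i : measurable_fun setT (fun w => v k w 0 i).
  by have [iV _ _ _] := vD k i; apply/measurable_EFinP; exact: measurable_int iV.
have gx k i := g_measurable_budget cB scheme (k := k) i.
have mx k i : measurable_fun setT (fun w => x k w 0 i).
  exact (g_measurableW (outcomes_measurable cB scheme mv (k := k)) (gx k i)).
(* [xi] pairs this noise with y - x, for tracking the maximizers; [zeta] pairs it with x, for
   outputs against mean outputs. *)
pose U j w i := v j w 0 i - clip Gam (D j w 0 i).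
pose xi w j := \sum_i U j w i * (y j - x j w) 0 i.
pose zeta w j := \sum_i U j w i * x j w 0 i.
have vxi : vanishing P (fun k w => `|avg (xi w) k|).
  apply: (vanishing_rate_noise (u := fun j w => y j - x j w) (K := 2 * rad)
    cB scheme mv vG vD).
    move=> k i.
    rewrite (_ : (fun _ => _) = (fun w => y k 0 i - x k w 0 i)).
      by apply: measurable_funB => //; exact: gx.
    by apply/funext => w; rewrite !mxE.
  move=> k w i; apply: le_trans (coord_le_enorm _ _) _.
  exact: in_ball_diameter ballB (yB k) (xB k w).
have vzeta : vanishing P (fun k w => `|avg (zeta w) k|).
  apply: (vanishing_rate_noise (u := x) (K := X) cB scheme mv vG vD).
    by move=> k i; exact: gx.
  move=> k w i; have x_ge0 := B0 _ (xB k w).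
  rewrite ger0_norm// -(xB k w).1 (bigD1 i)//= lerDl sumr_ge0//.
pose L := (2 * (h / 4) * s)^-1 / gam.
have L0 : 0 < L by rewrite divr_gt0 ?invr_gt0 ?mulr_gt0 ?divr_gt0.
(* A single error term dominating both noises, so that the three estimates below have the same
   form. *)
pose W k w := L * `|avg (xi w) k| + `|avg (zeta w) k|.
have vW : vanishing P W by exact: vanishingD.
pose K1 := (Num.bound ((2 * rad) ^+ 2 / (2 * eps * s ^+ 2))).+1.
pose dist w j := enorm (x j w - y j).
have clipD := ae_clip_id cB scheme mv vG vD.
have trackD w : (forall k i, clip Gam (D k w 0 i) = D k w 0 i) ->
    forall k, (K1 <= k)%N ->
  avg (dist w) k / gam <= c / gam * s + L * `|avg (xi w) k|.
  move=> cD k kK.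
  have := @tracking_error R N h Gam rad X delta eps Xm Xp (fun k i => gbar g i k)
    (x^~ w) y (v^~ w) (D^~ w) h_gt0 Gam_gt0 d0 eps0 epsE ballB Xm0 pf _
    (xB^~ w) _ (vG^~ w) ymax yd (gradD^~ w) k kK.
  have [_ _ sP] := scheme.
  move=> /(_ (fun k i a => fh i k a) (sP^~ w)).
  have -> : (fun j => dotp (v j w - D j w) (y j - x j w)) = xi w.
    by apply/funext => j; apply: eq_bigr => i _; rewrite !mxE /U cD.
  rewrite -(ler_pM2r (x := gam^-1)) ?invr_gt0// mulrDl.
  by move=> /le_trans; apply; rewrite le_eqVlt /L (mulrAC _ s) (mulrAC _ _ gam^-1) eqxx.
have adiff_le w j : adiff w j <= dist w j / gam.
  by rewrite ler_pdivlMr// mulrC; exact: glip (xB j w) (yB j).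
have avg_adiff w k : avg (adiff w) k <= avg (dist w) k / gam.
  by rewrite mulrC -avgZ; apply: ler_avg => j; rewrite mulrC.
have mean_le w j : `|gtot_mean g (x j w) j - gtot_mean g (y j) j| <= dist w j / gam.
  rewrite ler_pdivlMr// mulrC; apply: gtot_mean_lipschitz => //.
  - exact: B0.
  - exact: B0.
  - by move=> w'; apply: glip.
have mdiffE w : (forall k i, clip Gam (D k w 0 i) = D k w 0 i) ->
    forall j, mdiff w j = zeta w j + (gtot_mean g (x j w) j - gtot_mean g (y j) j).
  move=> cD j; rewrite /mdiff (gtot_eq_dotp scheme).
  suff -> : gtot_mean g (x j w) j = \sum_i D j w 0 i * x j w 0 i.
    rewrite addrA; congr (_ - _); rewrite /zeta -big_split/=.
    by apply: eq_bigr => i _; rewrite /U cD mulrBl subrK.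
  apply: eq_bigr => i _; apply/esym.
  exact: (gradient_mean_output (pf j) (B0 _ (xB j w)) (gradD j w)).
have avg_mdiff w : (forall k i, clip Gam (D k w 0 i) = D k w 0 i) ->
    forall k, `|avg (mdiff w) k| <= `|avg (zeta w) k| + avg (dist w) k / gam.
  move=> cD k.
  rewrite (_ : mdiff w = (fun j => zeta w j +
    (gtot_mean g (x j w) j - gtot_mean g (y j) j))); last first.
    by apply/funext => j; exact: mdiffE.
  rewrite avgD; apply: (le_trans (ler_normD _ _)); rewrite lerD2l.
  apply: (le_trans (ler_norm_avg _ _)); rewrite mulrC -avgZ.
  by apply: ler_avg => j; rewrite mulrC.
have m_gx j : measurable_fun setT (fun w => gtot g (x j w) j w).
  rewrite (_ : (fun _ => _) = (fun w => \sum_i v j w 0 i * x j w 0 i)).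
    by apply: measurable_sum => i; exact: measurable_funM.
  by apply/funext => w; rewrite (gtot_eq_dotp scheme).
have m_gy j : measurable_fun setT (gtot g (y j) j).
  by apply: measurable_sum => i.
have mQd k : measurable_fun setT (fun w => `|avg (diff w) k|).
  apply: measurableT_comp => //; apply: (measurable_avg (f := fun j w => diff w j)) => j.
  exact: measurable_funB.
have mQa k : measurable_fun setT (fun w => avg (adiff w) k).
  apply: (measurable_avg (f := fun j w => adiff w j)) => j.
  by apply: measurableT_comp => //; exact: measurable_funB.
have mQm k : measurable_fun setT (fun w => `|avg (mdiff w) k|).
  apply: measurableT_comp => //; apply: (measurable_avg (f := fun j w => mdiff w j)) => j.
  exact: measurable_funB.
have mQh k : measurable_fun setT (fun w => - avg (hdiff w) k).
  apply: measurableT_comp => //; apply: (measurable_avg (f := fun j w => hdiff w j)) => j.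
  exact: measurable_funB.
have Qa : \forall w \ae P, forall k, (K1 <= k)%N ->
    avg (adiff w) k <= c / gam * s + W k w.
  apply: filterS clipD => w cD k kK; apply: (le_trans (avg_adiff w k)).
  by apply: (le_trans (trackD w cD k kK)); rewrite lerD2l lerDl.
have Qm : \forall w \ae P, forall k, (K1 <= k)%N ->
    `|avg (mdiff w) k| <= c / gam * s + W k w.
  apply: filterS clipD => w cD k kK; apply: (le_trans (avg_mdiff w cD k)).
  by have := trackD w cD k kK; rewrite /W; lra.
have Qh : (forall i, Xm i = 0) -> \forall w \ae P, forall k, (K1 <= k)%N ->
    - avg (hdiff w) k <= c / gam * s + W k w.
  move=> Xm00; have XmE : Xm = (fun=> 0) by apply/funext => i; rewrite Xm00.
  apply: filterS Qm => w wm k kK; apply: le_trans (wm k kK).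
  (* This makes each [hdiff] at least [mdiff], so the lower bound for [hdiff] follows from the
     estimate for [mdiff]. *)
  have half j : 2^-1 * optimal_productivity g B j <= gtot_mean g (y j) j.
    rewrite mulrC ler_pdivrMr// mulrC.
    apply: ge_sup; first by case: Bn0 => b Bb; exists (gtot_mean g b j), b.
    move=> _ [z Bz <-]; move: (ymax j) Bz; rewrite /B XmE => yj zB.
    exact: (maximizer_half_optimal (pf j) yj zB).
  apply: (@le_trans _ _ (- avg (mdiff w) k)); last first.
    by rewrite -normrN ler_norm.
  rewrite lerN2; apply: ler_avg => j; rewrite lerB// .
have c'0 : 0 < c / gam * s by rewrite mulr_gt0 ?divr_gt0.
have boundE theta : bound theta = 2 * (c / gam * s) / theta.
  by rewrite /bound !mulrA.
split.
  have [Ka ha] := prob_le_of_vanishing c'0 mQa vW Qa.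
  have [Km hm] := prob_le_of_vanishing c'0 mQm vW Qm.
  (* The starting index is chosen before capped funding is assumed, so one decides classically
     whether it holds. *)
  have [Kh hh] : exists K : nat, (forall i, Xm i = 0) -> forall k, (K <= k)%N ->
      forall theta : R, 0 < theta ->
      ((1 - 2 * (c / gam * s) / theta)%:E <=
       P [set w | (- avg (hdiff w) k <= theta)%R])%E.
    have [/Qh Q|nX] := pselect (forall i, Xm i = 0); last by exists 0%N.
    by have [K hK] := prob_le_of_vanishing c'0 mQh vW Q; exists K.
  exists (maxn Ka (maxn Km Kh)) => k; rewrite !geq_max => /and3P[ak mk hk] theta th0.
  rewrite boundE; split; [exact: ha|exact: hm|move=> Xm00].
  rewrite (_ : [set w | - theta <= avg (hdiff w) k] =
    [set w | - avg (hdiff w) k <= theta]); first exact: hh.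
  by apply/seteqP; split=> w /=; rewrite lerNl.
move=> theta th0; rewrite boundE; split.
- apply: le_measure; rewrite ?inE.
  + exact: measurable_limn_esup_ge.
  + exact: measurable_limn_esup_ge.
  + move=> w /= /le_trans; apply; apply: le_limn_esup => k.
    rewrite lee_fin (le_trans (ler_norm_avg _ _))//.
    by apply: ler_avg => j; rewrite /diff distrC.
- exact: prob_limn_esup_of_vanishing c'0 mQa vW Qa _ th0.
- exact: prob_limn_esup_of_vanishing c'0 mQm vW Qm _ th0.
- move=> /Qh Q.
  (* A lower limit at most -theta is an upper limit of the negated averages at least theta. *)
  rewrite (_ : [set w | _] =
      [set w | (theta%:E <= limn_esup (fun k => (- avg (hdiff w) k)%:E))%E]).
    exact: prob_limn_esup_of_vanishing c'0 mQh vW Q _ th0.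
  apply/seteqP; split=> w /=; rewrite (_ : (fun k => (- avg (hdiff w) k)%:E) =
      -%E \o (fun k => (avg (hdiff w) k)%:E))// limn_esupN;
    by rewrite EFinN leeNr.
Qed.
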